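(* Let $0<p\le \frac34$ and $q\in(0,1)$, and let $(S_n)_{n\ge 0}$ be the elephant random walk with parameters $p,q$. Let $m\ge 0$ be an integer and let $y\in\mathbb{Z}\setminus\{0\}$ be such that $\mathbb{P}(S_m=y)>0$. Then $$\lim_{N\to\infty}\sqrt{A_{m+N}-A_m}\;\mathbb{P}_{(m,y)}(T_0>N)=\sqrt{\frac{2}{\pi}}\,|y|\,a_m .$$
   Context: Elephant random walk (ERW): $S_0=0$, $S_n=X_1+\cdots+X_n$ for $n\ge1$, where $X_1=+1$ with probability $q$ and $X_1=-1$ with probability $1-q$, and for $n\ge 1$, $X_{n+1}=+X_{U_n}$ with probability $p$ and $X_{n+1}=-X_{U_n}$ with probability $1-p$, with $U_n$ uniform on $\{1,\dots,n\}$; all random choices are mutually independent. $\mathbb{P}$ denotes its law. $(S_n)$ is a time-inhomogeneous Markov chain with $\mathbb{P}(S_{n+1}=x\pm1\mid S_n=x)=\frac12\pm(p-\frac12)\frac{x}{n}$ for $n\ge1$. $\mathbb{P}_{(m,y)}$ is the law of the ERW started from $y$ at time $m$, and $T_0$ is the first time $n\ge1$ at which the walk is at $0$, where under $\mathbb{P}_{(m,y)}$ time is counted from the starting time $m$; that is, $\mathbb{P}_{(m,y)}(T_0>N)=\mathbb{P}(S_{m+k}\ne0\text{ for all }1\le k\le N\mid S_m=y)$. $a_0:=0$, $a_n:=\dfrac{\Gamma(n)}{\Gamma(n+2p-1)}$ for $n\ge1$, and $A_n:=\sum_{j=1}^n a_j^2$ (with $A_0=0$). *)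

(* Defs.v *)
From HB Require Import structures.
From mathcomp Require Export all_boot all_order all_algebra.
From mathcomp Require Export all_classical all_reals all_analysis.
Set Implicit Arguments.
Unset Strict Implicit.
Unset Printing Implicit Defensive.
Import Order.TTheory GRing.Theory Num.Theory.
Import numFieldNormedType.Exports.
Local Open Scope classical_set_scope.
Local Open Scope ring_scope.

Section Independence.
Context d (T : measurableType d) (R : realType) (P : probability T R).

Definition sigma_of d' (T' : measurableType d') (Z : T -> T') : set_system T :=
  preimage_set_system setT Z measurable.

Definition mutually_independent (I : choiceType) (F : I -> set_system T) :=
  forall (J : seq I) (E : I -> set T), uniq J ->
    (forall i, i \in J -> F i (E i)) ->
    P (\bigcap_(i in [set` J]) E i) = (\prod_(i <- J) P (E i))%E.

(* Only meaningful when [P B] is not zero. *)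
Definition cond_prob (A B : set T) : R := fine (P (A `&` B)) / fine (P B).

End Independence.

Section ElephantRandomWalk.
Context d (T : measurableType d) (R : realType) (P : probability T R).

(* The sources of randomness are X_1 and, for each n >= 1, the pair (U_n, coin)
   that produces X_{n+1}; hence the shift, which leaves out the unused index 0. *)
Definition erw_randomness (X : nat -> {RV P >-> R}) (U : nat -> {RV P >-> nat})
    (coin : nat -> {RV P >-> bool}) (i : option (nat + nat)) : set_system T :=
  match i with
  | None => sigma_of (X 1)
  | Some (inl n) => sigma_of (U n.+1)
  | Some (inr n) => sigma_of (coin n.+1)
  end.

(* [X 0], [U 0] and [coin 0] play no role. On the null event where [U n] falls
   outside {1, ..., n}, [erw_step] is immaterial. *)
Record elephant_random_walk (p q : R) (X : nat -> {RV P >-> R})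
    (U : nat -> {RV P >-> nat}) (coin : nat -> {RV P >-> bool}) : Prop := {
  erw_first_pos : P [set t | X 1 t = 1] = q%:E;
  erw_first_neg : P [set t | X 1 t = -1] = (1 - q)%:E;
  erw_memory : forall n k : nat, (1 <= k <= n)%N ->
    P [set t | U n t = k] = (n%:R^-1)%:E;
  erw_coin : forall n : nat, (1 <= n)%N -> P [set t | coin n t = true] = p%:E;
  erw_step : forall n : nat, (1 <= n)%N -> forall t : T,
    X n.+1 t = if coin n t then X (U n t) t else - X (U n t) t;
  erw_indep : mutually_independent P (erw_randomness X U coin)
}.

Definition erw_position (X : nat -> {RV P >-> R}) (n : nat) (t : T) : R :=
  \sum_(1 <= i < n.+1) X i t.

End ElephantRandomWalk.

(* Time is counted from [m]; the value is +oo when the path never visits 0. *)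
Definition first_zero_after (R : realType) (s : nat -> R) (m : nat) : \bar R :=
  ereal_inf [set k%:R%:E | k in [set k : nat | (1 <= k)%N /\ s (m + k)%N = 0]].

(* Euler's integral, convergent for [0 < x] only. *)
Definition Gamma (R : realType) (x : R) : R :=
  \int[lebesgue_measure]_(t in `]0, +oo[) (t `^ (x - 1) * expR (- t)).

Definition erw_a (R : realType) (p : R) (n : nat) : R :=
  if n == 0%N then 0 else Gamma n%:R / Gamma (n%:R + 2 * p - 1).

Definition erw_A (R : realType) (p : R) (n : nat) : R :=
  \sum_(1 <= j < n.+1) erw_a p j ^+ 2.

(* Main.v *)
Require Import Defs.
From mathcomp Require Import ring lra zify measurable_realfun.
Import Order.TTheory GRing.Theory Num.Theory.
Import numFieldNormedType.Exports.
Local Open Scope classical_set_scope.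
Local Open Scope ring_scope.
Set Implicit Arguments.
Unset Strict Implicit.
Unset Printing Implicit Defensive.

(** The theorem is the analogue of the reflection principle
    [P (no zero before time t) ~ Num.sqrt (2 / (pi * t)) * x] for a Brownian motion
    started at [x], and it is proved by Laplace transforms.

    Let [alpha = 2 * p - 1]. By the functional equation of Gamma, [a n * S n] is a
    martingale with steps close to [+- a n], and [A n] is its clock, which tends to
    infinity for [p <= 3 / 4]. For a Brownian motion [B] at time [t],
    [expR (- s * B - s ^ 2 * t / 2)] is a martingale. Stopped at the first zero, it
    shows that the sum over [n] of the survival probability [b n] times the
    increment of [- expR (- s ^ 2 * A n / 2)] is [1 - expR (- s * a m * |y|)], which
    is [s * a m * |y|] to first order. For the elephant the same computation
    ([laplace_sumE]) has an error term, the total defect of the exponential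
    martingale. A Hoeffding estimate that is sharp on both sides
    ([two_point_mgf_bounds]) bounds the defect of one step by
    [(alpha * x / n) ^ 2 * (s * a n) ^ 2 + (s * a n) ^ 4], and the sum of these bounds
    is [o (s)] ([laplace_sum_le]): the first term because
    [z ^ 2 * expR (- z) <= z] turns it into [s * a n * x / n ^ 2], where the mass of
    [a n * x] does not depend on [n], and the second because [n * a n ^ 2 <= 3 * A n].

    Thus the Laplace transform of [b] along the clock is asymptotic to a multiple of
    the square root of the Laplace variable. As [b] is nonincreasing, a Tauberian
    theorem ([sqrt_tauberian]) gives the asymptotics of [b] itself. It is proved by
    testing against the powers of [4 * x * (1 - x)], [x = expR (- u)], which
    concentrate at one point. The constant [Num.sqrt pi] enters through the Gaussian
    integral ([kernel_positivity]).

    It remains to see the elephant as a Markov chain. The law of its sign paths is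
    computed step by step from the independence of the memory and the coins
    ([path_prob_cons]); the next step depends on the past only through the
    position ([next_weightE]), and the distance to [0] is a killed Markov chain
    ([walk_weight_killed]). *)

(** * Exponential moments of a two-point law *)

Lemma derive_ge0_ge_start (R : realType) (f df : R -> R) (a t : R) :
  (forall x : R, a <= x -> is_derive x (1 : R) f (df x)) ->
  (forall x, a <= x -> 0 <= df x) ->
  a <= t -> f a <= f t.
Proof.
move=> fdf df0 at0; have fder x : x \in `[a, t] -> is_derive x (1 : R) f (df x).
  by rewrite in_itv /= => /andP[ax _]; exact: fdf.
have fder_oo x : x \in `]a, t[ -> is_derive x (1 : R) f (df x).
  by move=> xin; apply: fder; exact: subset_itv_oo_cc xin.
have fcont : {within `[a, t], continuous f}.
  by apply: derivable_within_continuous => x xin; have [] := fder x xin.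
have [c /itvP cin] := @MVT_segment R f df a t at0 fder_oo fcont.
rewrite -subr_ge0 => ->; apply: mulr_ge0; last by rewrite subr_ge0.
by apply: df0; rewrite cin.
Qed.

(** Hoeffding's lemma for the law on {-1, 1} of mean [- mu], together with the
    matching lower bound. With [q] the moment generating function and
    [D = q'/q - x + mu] one has [D' = - (q'/q)^2], which is nonpositive and at
    least [- (2 mu^2 + 2 x^2)]; integrating this bound twice from [0] gives both
    inequalities. *)
Lemma two_point_mgf_bounds (R : realType) (mu t : R) : `|mu| < 1 -> 0 <= t ->
  1 - (mu ^+ 2 * t ^+ 2 + t ^+ 4) <=
  expR (mu * t - t ^+ 2 / 2) *
    ((1 + mu) / 2 * expR (- t) + (1 - mu) / 2 * expR t) <= 1.
Proof.
rewrite ltr_norml => /andP[mu1 mu2] t0.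
pose q (x : R) := (1 + mu) / 2 * expR (- x) + (1 - mu) / 2 * expR x.
pose q' (x : R) := - ((1 + mu) / 2 * expR (- x)) + (1 - mu) / 2 * expR x.
pose D (x : R) := q' x * (q x)^-1 - x + mu.
pose F (x : R) := expR (mu * x - x ^+ 2 / 2) * q x.
have q_gt0 (x : R) : 0 < q x.
  by apply: addr_gt0; apply: mulr_gt0; rewrite ?expR_gt0 //; lra.
have qq' (x : R) : is_derive x (1:R) q (q' x).
  by apply: is_derive_eq; rewrite /q' /GRing.scale /=; ring.
have q'q (x : R) : is_derive x (1:R) q' (q x).
  by apply: is_derive_eq; rewrite /q /GRing.scale /=; ring.
have DD (x : R) : is_derive x (1:R) D (- (q' x / q x) ^+ 2).
  have qx := q_gt0 x.
  have Vq : is_derive x (1:R) (fun y => (q y)^-1) (- (q x) ^- 2 *: q' x).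
    by apply: is_deriveV; rewrite gt_eqF.
  apply: is_derive_eq.
  rewrite /GRing.scale /=; move: (q x) (q' x) qx => a b a0.
  by field; rewrite gt_eqF.
have FF (x : R) : is_derive x (1:R) F (F x * D x).
  have qx := q_gt0 x.
  apply: is_derive_eq.
  rewrite /GRing.scale /= /F /D; move: (q x) (q' x) (expR _) qx => a b c a0.
  by field; rewrite gt_eqF.
have D0 : D 0 = 0.
  have q0 : q 0 = 1 by rewrite /q oppr0 expR0; field.
  have q'0 : q' 0 = - mu by rewrite /q' oppr0 expR0; field.
  by rewrite /D q0 q'0; field.
have D_le0 (x : R) : 0 <= x -> D x <= 0.
  move=> x0; rewrite -oppr_ge0 -[leLHS]oppr0 -{1}D0.
  apply: (@derive_ge0_ge_start R (fun y => - D y) (fun y => (q' y / q y) ^+ 2) 0 x) => // y.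
    by move=> _; apply: is_derive_eq; rewrite opprK.
  by rewrite sqr_ge0.
have v_bound (x : R) : 0 <= x -> (q' x / q x) ^+ 2 <= 2 * mu ^+ 2 + 2 * x ^+ 2.
  move=> x0; have Dx := D_le0 x x0.
  have q'mu : - mu * q x <= q' x.
    rewrite /q /q'; have := ler_expR (- x) x; have := expR_gt0 x; have := expR_gt0 (- x).
    have -> : - x <= x by lra.
    move=> ep em; rewrite -subr_ge0 => exx.
    have : 0 <= (1 - mu) * (1 + mu) * (expR x - expR (- x)).
      by rewrite !mulr_ge0 ?exx //; lra.
    lra.
  have vmu : - mu <= q' x / q x by rewrite ler_pdivlMr.
  move: Dx vmu; rewrite /D; move: (q' x / q x) => v vx vmu.
  have : (v + mu) ^+ 2 <= x ^+ 2 by rewrite ler_pXn2r ?nnegrE //; lra.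
  have := sqr_ge0 (v + 2 * mu); lra.
have D_ge (x : R) : 0 <= x -> - (2 * mu ^+ 2 * x + x ^+ 3) <= D x.
  move=> x0; rewrite -subr_ge0 -(_ : D 0 + (2 * mu ^+ 2 * 0 + 0 ^+ 3) = 0); last first.
    by rewrite D0 expr0n /=; ring.
  rewrite opprK.
  apply: (@derive_ge0_ge_start R (fun y => D y + (2 * mu ^+ 2 * y + y ^+ 3))
    (fun y => - (q' y / q y) ^+ 2 + (2 * mu ^+ 2 + 3 * y ^+ 2)) 0 x) => // y.
    by move=> _; apply: is_derive_eq; rewrite /GRing.scale /=; ring.
  by move=> y0; have := v_bound y y0; have := sqr_ge0 y; nra.
have F_gt0 (x : R) : 0 < F x by rewrite mulr_gt0 ?expR_gt0.
have F0 : F 0 = 1 by rewrite /F /q oppr0 !expr0n /= mulr0 mul0r subr0 expR0; field.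
have F_le1 (x : R) : 0 <= x -> F x <= 1.
  move=> x0; rewrite -F0 -lerN2.
  apply: (@derive_ge0_ge_start R (fun y => - F y) (fun y => - (F y * D y)) 0 x) => // y.
  by move=> y0; rewrite oppr_ge0 mulr_ge0_le0 ?D_le0 //; exact/ltW.
rewrite F_le1 // andbT.
have : F 0 + (mu ^+ 2 * 0 ^+ 2 + 0 ^+ 4) <= F t + (mu ^+ 2 * t ^+ 2 + t ^+ 4).
  apply: (@derive_ge0_ge_start R (fun y => F y + (mu ^+ 2 * y ^+ 2 + y ^+ 4))
    (fun y => F y * D y + (2 * mu ^+ 2 * y + 4 * y ^+ 3)) 0 t) => // y.
    by move=> _; apply: is_derive_eq; rewrite /GRing.scale /=; ring.
  move=> y0; have Dy := D_ge y y0; have D0y := D_le0 y y0.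
  have : D y <= F y * D y.
    by rewrite -{1}(mul1r (D y)) ler_wnM2r // F_le1.
  have : 0 <= y ^+ 3 by exact: exprn_ge0.
  lra.
by rewrite F0 !expr0n /= mulr0 !addr0 lerBlDr.
Qed.

(** * Normalizing sequences *)

(** The recursion makes [a n * S n] a martingale when the step from time [n] at
    position [x] has mean [alpha * x / n]. The condition [alpha <= 1 / 2], that is
    [p <= 3 / 4], is what makes the sum of the squares diverge. *)
Record normalizing (R : realType) (alpha : R) (a : nat -> R) : Prop := {
  norm_alpha_gtN1 : -1 < alpha;
  norm_alpha_le : alpha <= 1 / 2;
  norm_gt0 : forall n, (0 < n)%N -> 0 < a n;
  normS : forall n, (0 < n)%N -> a n.+1 * (n%:R + alpha) = n%:R * a n
}.

Section NormalizingSequence.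
Context (R : realType) (alpha : R) (a : nat -> R).
Definition sum_sqr (n : nat) : R := \sum_(1 <= j < n.+1) a j ^+ 2.

Lemma sum_sqrS n : sum_sqr n.+1 = sum_sqr n + a n.+1 ^+ 2.
Proof. by rewrite /sum_sqr big_nat_recr. Qed.

Lemma sum_sqr_nondecreasing : nondecreasing_seq sum_sqr.
Proof.
by apply/nondecreasing_seqP => n; rewrite sum_sqrS lerDl sqr_ge0.
Qed.

Lemma natr_ge1 n : (0 < n)%N -> 1 <= n%:R :> R.
Proof. by move=> n0; rewrite (ler_nat R 1). Qed.

Lemma a_step_le n : normalizing alpha a -> (0 < n)%N -> a n.+1 <= 2 / (1 + alpha) * a n.
Proof.
move=> nrm; have [alpha_gtN1 alpha_le_half a_gt0 aS] := nrm.
move=> n0; have n1 := natr_ge1 n0; have an := a_gt0 _ n0.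
have aSn := a_gt0 n.+1 (ltn0Sn n).
have alpha1 : 0 < 1 + alpha by lra.
rewrite mulrAC ler_pdivlMr // -(ler_pM2l (_ : 0 < n%:R)) ?ltr0n //.
rewrite [leRHS]mulrCA -aS // mulrA [n%:R * _]mulrC mulrCA -mulrA ler_pM2l //.
have : 0 <= (n%:R - 1) * (1 - alpha) by apply: mulr_ge0; lra.
lra.
Qed.

(** The increment of [n * a n ^ 2] at [n] is at most [1 - 2 alpha] times
    [a n.+1 ^ 2], and [1 - 2 alpha < 3]. *)
Lemma natr_sqr_le_sum n : normalizing alpha a -> (0 < n)%N -> n%:R * a n ^+ 2 <= 3 * sum_sqr n.
Proof.
move=> nrm; have [alpha_gtN1 alpha_le_half a_gt0 aS] := nrm.
elim: n => // -[_ _|n IH _].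
  by rewrite /sum_sqr big_nat1 mul1r ler_peMl ?sqr_ge0 //; lra.
rewrite sum_sqrS mulrDr; apply: le_trans (lerD (IH isT) (lexx _)).
rewrite -lerBlDr -mulrBl.
have n1 := natr_ge1 (ltn0Sn n); have := aS n.+1 isT.
rewrite -[n.+2%:R]natr1; move: (n.+1%:R : R) (a n.+2) (a n.+1) n1 => k b c k1 e.
have k0 : 0 < k by lra.
rewrite -(ler_pM2l k0).
have -> : k * (k * c ^+ 2) = (b * (k + alpha)) ^+ 2 by rewrite e; ring.
rewrite exprMn mulrA [_ * b ^+ 2]mulrC ler_wpM2l ?sqr_ge0 //.
have := sqr_ge0 alpha; have : 0 <= k * (1 + alpha) by apply: mulr_ge0; lra.
by lra.
Qed.

(** The sequence [(n - 1 / 2) * a n ^ 2] is nondecreasing: the shift by [1 / 2]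
    absorbs the second-order term in the critical case [alpha = 1 / 2]. *)
Lemma sqr_ge_inv n : normalizing alpha a -> (0 < n)%N -> a 1%N ^+ 2 / 2 / n%:R <= a n ^+ 2.
Proof.
move=> nrm; have [alpha_gtN1 alpha_le_half a_gt0 aS] := nrm.
move=> n0; have : a 1%N ^+ 2 / 2 <= (n%:R - 2^-1) * a n ^+ 2.
  elim: n n0 => // -[_ _|n IH _]; first by lra.
  apply: le_trans (IH isT) _; have n1 := natr_ge1 (ltn0Sn n); have := aS n.+1 isT.
  have := a_gt0 n.+2 isT.
  rewrite -[n.+2%:R]natr1; move: (n.+1%:R : R) (a n.+2) (a n.+1) n1 => k b c k1 b0 e.
  have k0 : 0 < k by lra.
  rewrite -(ler_pM2l (exprn_gt0 2 k0)).
  have -> : k ^+ 2 * ((k - 2^-1) * c ^+ 2) = (k - 2^-1) * (k + alpha) ^+ 2 * b ^+ 2.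
    by transitivity ((k - 2^-1) * (k * c) ^+ 2); [ring|rewrite -e; ring].
  rewrite [leRHS]mulrA ler_wpM2r ?sqr_ge0 //.
  apply: (@le_trans _ _ ((k - 2^-1) * (k + 2^-1) ^+ 2)).
    by apply: ler_wpM2l; [lra|apply: lerXn2r; rewrite ?nnegrE; lra].
  have -> : (k - 2^-1) * (k + 2^-1) ^+ 2 =
    k ^+ 2 * (k + 1 - 2^-1) - 4^-1 * (k + 2^-1) by field.
  lra.
move=> H; rewrite ler_pdivrMr ?ltr0n //; apply: le_trans H _.
by rewrite mulrC; apply: ler_wpM2l; [exact: sqr_ge0|lra].
Qed.

Lemma sum_sqr_cvgy : normalizing alpha a -> sum_sqr n @[n --> \oo] --> +oo.
Proof.
move=> nrm; have [alpha_gtN1 alpha_le_half a_gt0 aS] := nrm.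
have A_mono := sum_sqr_nondecreasing.
have [cv|/(nondecreasing_dvgn_lt A_mono)//] := pselect (cvgn sum_sqr).
have c0 : 0 < a 1%N ^+ 2 / 2 by rewrite divr_gt0 // exprn_gt0 // a_gt0.
exfalso; apply: (@dvg_harmonic R).
apply: nondecreasing_is_cvgn.
  by apply: nondecreasing_series => n _ _; rewrite invr_ge0.
exists (limn sum_sqr / (a 1%N ^+ 2 / 2)) => _ [n _ <-].
rewrite ler_pdivlMr //; apply: le_trans (nondecreasing_cvgn_le A_mono cv n).
rewrite /series /sum_sqr /= mulr_suml big_add1 /=.
by apply: ler_sum => i _; rewrite mulrC; exact: sqr_ge_inv.
Qed.

End NormalizingSequence.

(** * The walk killed at zero *)
Section KilledWalk.
Context (R : realType).

Definition mass (w : nat -> nat -> R) (n : nat) (h : nat -> R) : R :=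
  \sum_(1 <= x < n.+1) w n x * h x.

Definition mean_next (alpha : R) (n : nat) (h : nat -> R) (x : nat) : R :=
  (1 + alpha * x%:R / n%:R) / 2 * h x.+1 + (1 - alpha * x%:R / n%:R) / 2 * h x.-1.

(** Here [w n x] stands for the probability that the distance of the walk to [0]
    is [x] at time [n] and that the walk has not visited [0] after time [m],
    given that it starts at distance [y] at time [m]. Since the transition
    probabilities of the elephant are invariant under a change of sign, the
    distance to [0] is a Markov chain up to the first visit to [0]; testing only
    against functions that vanish at [0] is what kills it there. *)
Record killed_walk (alpha : R) (m y : nat) (w : nat -> nat -> R) : Prop := {
  killed_m_gt0 : (0 < m)%N;
  killed_ge0 : forall n x, 0 <= w n x;
  killed_start : forall h, mass w m h = h y;
  killed_step : forall n h, (m <= n)%N -> h 0%N = 0 ->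
    mass w n.+1 h = mass w n (mean_next alpha n h)
}.

Lemma eq_mass w n (g h : nat -> R) :
  (forall x, (0 < x <= n)%N -> g x = h x) -> mass w n g = mass w n h.
Proof. by move=> gh; apply: eq_big_nat => x xn; rewrite gh. Qed.

Lemma massB w n (g h : nat -> R) : mass w n (fun x => g x - h x) = mass w n g - mass w n h.
Proof. by rewrite /mass -sumrB; apply: eq_bigr => x _; rewrite mulrBr. Qed.

Lemma massD w n (g h : nat -> R) : mass w n (fun x => g x + h x) = mass w n g + mass w n h.
Proof. by rewrite /mass -big_split; apply: eq_bigr => x _; rewrite mulrDr. Qed.

Lemma massZ w n c (h : nat -> R) : mass w n (fun x => c * h x) = c * mass w n h.
Proof. by rewrite /mass mulr_sumr; apply: eq_bigr => x _; rewrite mulrCA. Qed.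

Section Walk.
Context (alpha : R) (m y : nat) (w : nat -> nat -> R) (a : nat -> R).
Implicit Types (kw : killed_walk alpha m y w) (nrm : normalizing alpha a).

Definition survival n := mass w n (fun=> 1).

Lemma le_mass kw n (g h : nat -> R) :
  (forall x, (0 < x <= n)%N -> g x <= h x) -> mass w n g <= mass w n h.
Proof.
move=> gh; apply: ler_sum_nat => x xn.
by rewrite ler_wpM2l ?gh ?(killed_ge0 kw).
Qed.

Lemma mass_ge0 kw n (h : nat -> R) :
  (forall x, (0 < x <= n)%N -> 0 <= h x) -> 0 <= mass w n h.
Proof.
move=> h0; have <- : mass w n (fun=> 0) = 0 by rewrite /mass big1 // => x _; rewrite mulr0.
exact: le_mass.
Qed.

Lemma survival_ge0 kw n : 0 <= survival n.
Proof. by apply: mass_ge0. Qed.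

Lemma drift_lt1 nrm x n : (0 < x <= n)%N -> `|alpha * x%:R / n%:R| < 1.
Proof.
have [alpha_gtN1 alpha_le_half _ _] := nrm.
case/andP=> x0 xn; have n0 : (0 < n)%N by exact: leq_trans xn.
rewrite -mulrA normrM [X in _ * X]ger0_norm ?divr_ge0 //.
have : x%:R / n%:R <= 1 :> R by rewrite ler_pdivrMr ?ltr0n // mul1r ler_nat.
have : 0 <= x%:R / n%:R :> R by rewrite divr_ge0.
have : `|alpha| < 1 by rewrite ltr_norml; lra.
move: `|alpha| (normr_ge0 alpha) (x%:R / n%:R) => u u0 v u1 v0 v1.
by apply: le_lt_trans u1; rewrite ler_piMr.
Qed.

Lemma survivalS kw nrm n : (m <= n)%N -> survival n.+1 <= survival n.
Proof.
move=> mn; pose h x : R := (x != 0)%N%:R.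
have -> : survival n.+1 = mass w n.+1 h.
  by apply: eq_mass => -[].
rewrite (killed_step kw) //; apply: (le_mass kw) => x xn.
have := drift_lt1 nrm xn; rewrite /mean_next /h /= ltr_norml.
move: (alpha * _ / _) => u /andP[u1 u2].
case: (x.-1 != 0)%N => /=; lra.
Qed.

(** Up to the first visit to [0] the distance has the drift of the walk, which [a]
    compensates; it vanishes there, so that the killing loses nothing. *)
Lemma mass_martingale kw nrm n : (m <= n)%N -> a n * mass w n (fun x => x%:R) = a m * y%:R.
Proof.
have [_ _ _ aS] := nrm; move=> /subnK <-.
elim: (n - m)%N => [|k IH]; first by rewrite add0n (killed_start kw).
have km0 : (0 < k + m)%N by rewrite addn_gt0 (killed_m_gt0 kw) orbT.
rewrite addSn (killed_step kw) ?leq_addl // -IH.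
have km1 : (k + m)%:R != 0 :> R by rewrite pnatr_eq0 -lt0n.
have -> : a (k + m)%N = a (k + m).+1 * (1 + alpha / (k + m)%:R).
  apply: (mulfI km1); rewrite -aS //.
  by move: ((k + m)%:R : R) km1 => N N0; field.
rewrite -mulrA; congr (_ * _); rewrite -massZ; apply: eq_mass => -[|x] // _.
rewrite /mean_next /= -[x.+2%:R]natr1 -[x.+1%:R]natr1.
by move: ((k + m)%:R : R) (x%:R : R) km1 => N z N0; field.
Qed.

Definition clock n := sum_sqr a n - sum_sqr a m.

Definition exp_clock (s : R) n := expR (- (s ^+ 2 / 2 * clock n)).

(** If [a n * S n] were a Brownian motion run at speed [clock], this would be its
    exponential martingale of parameter [- s]. *)
Definition exp_walk (s : R) n (x : nat) := expR (- (s * a n * x%:R)) * exp_clock s n.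

Lemma clockS n : clock n.+1 = clock n + a n.+1 ^+ 2.
Proof. by rewrite /clock sum_sqrS addrAC. Qed.

(** The recursion for [a] turns [s * a n * x] into [t * x + mu * t], so that
    exactly the centred two-point exponential moment remains. *)
Lemma mean_next_exp_walk nrm (s : R) n x : (0 < x <= n)%N ->
  let mu := alpha * x%:R / n%:R in let t := s * a n.+1 in
  mean_next alpha n (exp_walk s n.+1) x = exp_walk s n x *
    (expR (mu * t - t ^+ 2 / 2) * ((1 + mu) / 2 * expR (- t) + (1 - mu) / 2 * expR t)).
Proof.
have [_ _ _ aS] := nrm; case: x => // x /= xn.
have n0 : (0 < n)%N by exact: leq_trans xn.
have n1 : n%:R != 0 :> R by rewrite pnatr_eq0 -lt0n.
set mu := alpha * _ / _; set t := s * a n.+1.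
have anE : s * a n * x.+1%:R = t * x.+1%:R + mu * t.
  rewrite /mu /t; apply: (mulfI n1).
  transitivity (s * x.+1%:R * (n%:R * a n)); first by ring.
  by rewrite -aS //; move: (n%:R : R) n1 (x.+1%:R : R) => N N0 z; field.
rewrite /mean_next /exp_walk /exp_clock anE clockS -!expRD /=.
have -> : - (s * a n.+1 * x.+2%:R) - s ^+ 2 / 2 * (clock n + a n.+1 ^+ 2) =
    - (t * x.+1%:R + mu * t) - s ^+ 2 / 2 * clock n + (mu * t - t ^+ 2 / 2) + - t.
  by rewrite -[x.+2%:R]natr1 /t; field.
have -> : - (s * a n.+1 * x%:R) - s ^+ 2 / 2 * (clock n + a n.+1 ^+ 2) =
    - (t * x.+1%:R + mu * t) - s ^+ 2 / 2 * clock n + (mu * t - t ^+ 2 / 2) + t.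
  by rewrite -[x.+1%:R]natr1 /t; field.
rewrite !expRD -/mu; ring.
Qed.

Definition defect (s : R) n x := exp_walk s n x - mean_next alpha n (exp_walk s n.+1) x.

Lemma defect_bounds nrm (s : R) n x : 0 <= s -> (0 < x <= n)%N ->
  let mu := alpha * x%:R / n%:R in let t := s * a n.+1 in
  0 <= defect s n x <= exp_walk s n x * (mu ^+ 2 * t ^+ 2 + t ^+ 4).
Proof.
move=> s0 xn /=; set mu := alpha * _ / _; set t := s * a n.+1.
rewrite /defect mean_next_exp_walk // -/mu -/t.
have [_ _ a_gt0 _] := nrm.
have t0 : 0 <= t by rewrite mulr_ge0 // ltW // a_gt0.
have /andP[] := two_point_mgf_bounds (drift_lt1 nrm xn) t0.
rewrite -/mu; move: (expR _ * (_ + _)) => F F1 F2.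
have H0 : 0 <= exp_walk s n x by rewrite mulr_ge0 ?expR_ge0.
rewrite -{1 3}[exp_walk s n x]mulr1 -mulrBr mulr_ge0 ?subr_ge0 //=.
by rewrite ler_wpM2l // lerBlDr addrC -lerBlDr.
Qed.

Definition laplace_sum (s : R) N :=
  \sum_(m <= n < N) survival n * (exp_clock s n - exp_clock s n.+1).

(** The function [exp_walk s n - exp_clock s n] vanishes at [0], so that its mass
    evolves by [mean_next]. Its increment at time [n] is minus the defect of the
    exponential martingale plus the survival probability times the decrease of
    [exp_clock]; the sum over [n] telescopes. *)
Lemma laplace_sumE kw (s : R) N : (m <= N)%N -> laplace_sum s N =
  (mass w N (exp_walk s N) - exp_clock s N * survival N) + (1 - expR (- (s * a m * y%:R)))
    + \sum_(m <= n < N) mass w n (defect s n).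
Proof.
move=> mN; pose u n := mass w n (exp_walk s n) - exp_clock s n * survival n.
have um : u m = expR (- (s * a m * y%:R)) - 1.
  rewrite /u /survival !(killed_start kw) /exp_walk /exp_clock /clock subrr mulr0 oppr0.
  by rewrite expR0 !mulr1.
transitivity (\sum_(m <= n < N) (u n.+1 - u n + mass w n (defect s n))); last first.
  rewrite big_split /= telescope_sumr // um -/(u N) opprB.
  by rewrite [_ - expR _]addrC.
apply: eq_big_nat => n /andP[mn nN].
have step : mass w n.+1 (exp_walk s n.+1) - exp_clock s n.+1 * survival n.+1 =
    mass w n (mean_next alpha n (exp_walk s n.+1)) - exp_clock s n.+1 * survival n.
  rewrite /survival -!massZ -!massB (killed_step kw) //; last first.
    by rewrite /exp_walk mulr0 oppr0 expR0; ring.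
  by apply: eq_mass => x _; rewrite /mean_next; move: (alpha * _ / _) => v; field.
rewrite {1}/u step /u /defect massB; ring.
Qed.

Lemma survival_le1 kw nrm n : (m <= n)%N -> survival n <= 1.
Proof.
move=> /subnK <-; elim: (n - m)%N => [|k IH].
  by rewrite /survival (killed_start kw).
by apply: le_trans IH; rewrite addSn; apply: (survivalS kw nrm); exact: leq_addl.
Qed.

(** A surviving walk is at distance at least [1] from [0], so that the martingale
    bounds its survival probability. *)
Lemma survival_scale kw nrm n : (m <= n)%N -> a n * survival n <= a m * y%:R.
Proof.
move=> mn; rewrite -(mass_martingale kw nrm mn).
have [_ _ a_gt0 _] := nrm.
have n0 : (0 < n)%N by exact: leq_trans (killed_m_gt0 kw) mn.
rewrite ler_pM2l ?a_gt0 //; apply: (le_mass kw) => x /andP[x0 _].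
by rewrite (ler_nat R 1).
Qed.

(** An upper bound of all ratios [a n.+1 / a n]. *)
Definition ratio_bound := 2 / (1 + alpha).
Notation C := ratio_bound.

Lemma exp_clock_le1 (s : R) n : (m <= n)%N -> exp_clock s n <= 1.
Proof.
move=> mn; rewrite -expR0 ler_expR oppr_le0 mulr_ge0 //.
  by rewrite divr_ge0 ?sqr_ge0.
by rewrite subr_ge0 sum_sqr_nondecreasing.
Qed.

Lemma sqr_mul_exp_le (z : R) : 0 <= z -> z ^+ 2 * expR (- z) <= z.
Proof.
move=> z0; rewrite expRN ler_pdivrMr ?expR_gt0 // expr2 ler_wpM2l //.
by apply: le_trans (expR_ge1Dx z); lra.
Qed.

(** Of the bound [mu ^ 2 * t ^ 2 + t ^ 4] on the relative defect, the first term is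
    of order [(s * a n * x / n) ^ 2]. Against the factor [expR (- (s * a n * x))]
    it costs at most [s * a n * x / n ^ 2], whose mass is known from the martingale,
    and also, as [x <= n], at most [(s * a n) ^ 2]. The former bound is summable,
    the latter is small for each fixed [n]. In the second term one factor
    [a n.+1] is traded for [a m * y] through [survival_scale]. *)
Lemma mass_defect_le kw nrm (s : R) n : 0 <= s -> (m <= n)%N ->
  mass w n (defect s n) <=
    C ^+ 2 * Num.min (s * (a m * y%:R) / n%:R ^+ 2) (s ^+ 2 * a n ^+ 2)
    + C * (a m * y%:R) * s * (exp_clock s n * (s * a n.+1) ^+ 3).
Proof.
move=> s0 mn; have [alpha_gtN1 alpha_le_half a_gt0 aS] := nrm.
have n0 : (0 < n)%N by exact: leq_trans (killed_m_gt0 kw) mn.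
have n1 : 0 < n%:R :> R by rewrite ltr0n.
have an := a_gt0 _ n0; have an1 := a_gt0 _ (ltn0Sn n).
have e0 : 0 <= exp_clock s n := expR_ge0 _.
have e1 := exp_clock_le1 s mn.
have C0 : 0 <= C by rewrite divr_ge0 //; lra.
have b0 := survival_ge0 kw n.
have C20 : 0 <= C ^+ 2 by exact: sqr_ge0.
have alpha2 : alpha ^+ 2 <= 1.
  by have : 0 <= (1 - alpha) * (1 + alpha) by [apply: mulr_ge0; lra]; lra.
set quart := _ * (_ ^+ 3).
have quart0 : 0 <= quart by rewrite mulr_ge0 // exprn_ge0 // mulr_ge0 // ltW.
have quartE : exp_clock s n * (s * a n.+1) ^+ 4 * survival n <= quart * s * C * (a m * y%:R).
  have -> : exp_clock s n * (s * a n.+1) ^+ 4 * survival n =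
    quart * s * (a n.+1 * survival n) by rewrite /quart; ring.
  rewrite -[leRHS]mulrA; apply: ler_wpM2l; first exact: mulr_ge0.
  apply: (@le_trans _ _ (C * (a n * survival n))).
    by rewrite mulrA ler_wpM2r // (a_step_le nrm n0).
  by rewrite ler_wpM2l // (survival_scale kw nrm).
pose quad x := C ^+ 2 / n%:R ^+ 2 * ((s * a n * x%:R) ^+ 2 * expR (- (s * a n * x%:R))).
have split_le : mass w n (defect s n) <=
    mass w n quad + exp_clock s n * (s * a n.+1) ^+ 4 * survival n.
  rewrite /survival -massZ -massD; apply: (le_mass kw) => x xn.
  have /andP[_ /le_trans] := defect_bounds nrm s0 xn; apply.
  rewrite /exp_walk mulrDr; apply: lerD.
    set z := s * a n * _; set mu := alpha * _ / _.
    have z0 : 0 <= z by rewrite /z !mulr_ge0 // ltW.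
    have mutz : mu ^+ 2 * (s * a n.+1) ^+ 2 <= C ^+ 2 / n%:R ^+ 2 * z ^+ 2.
      have -> : mu ^+ 2 * (s * a n.+1) ^+ 2 = alpha ^+ 2 * (s * a n.+1 * x%:R / n%:R) ^+ 2.
        by rewrite /mu; move: (n%:R : R) n1 => N N1; field; rewrite gt_eqF.
      have -> : C ^+ 2 / n%:R ^+ 2 * z ^+ 2 = (s * (C * a n) * x%:R / n%:R) ^+ 2.
        by rewrite /z; move: (n%:R : R) n1 => N N1; field; rewrite gt_eqF.
      apply: (@le_trans _ _ ((s * a n.+1 * x%:R / n%:R) ^+ 2)).
        by rewrite ler_piMl ?sqr_ge0.
      have le1 : s * a n.+1 * x%:R / n%:R <= s * (C * a n) * x%:R / n%:R.
        by rewrite !ler_wpM2r ?invr_ge0 ?ler0n // ler_wpM2l // (a_step_le nrm).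
      have ge0 : 0 <= s * a n.+1 * x%:R / n%:R by rewrite !mulr_ge0 ?invr_ge0 // ltW.
      by apply: lerXn2r => //; rewrite nnegrE // (le_trans ge0).
    rewrite [leLHS]mulrC; apply: (@le_trans _ _ (mu ^+ 2 * (s * a n.+1) ^+ 2 * expR (- z))).
      by rewrite mulrA ler_piMr // mulr_ge0 ?expR_ge0 // mulr_ge0 ?sqr_ge0.
    by rewrite /quad [leRHS]mulrA; apply: ler_wpM2r mutz; exact: expR_ge0.
  rewrite mulr1; apply: ler_wpM2r; first by rewrite exprn_ge0 // mulr_ge0 // ltW.
  by rewrite ler_piMl // -expR0 ler_expR oppr_le0 !mulr_ge0 // ltW.
apply: (le_trans split_le); apply: lerD; last first.
  by apply: le_trans quartE _; rewrite le_eqVlt; apply/orP; left; apply/eqP; ring.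
rewrite minr_pMr // le_min; apply/andP; split.
  apply: (@le_trans _ _ (C ^+ 2 / n%:R ^+ 2 * (s * (a n * mass w n (fun x => x%:R))))).
    rewrite -!massZ; apply: (le_mass kw) => x xn; rewrite /quad ler_wpM2l //.
      by rewrite divr_ge0 // sqr_ge0.
    by rewrite mulrA sqr_mul_exp_le // !mulr_ge0 // ltW.
  by rewrite (mass_martingale kw nrm) // mulrAC -!mulrA.
apply: (@le_trans _ _ (C ^+ 2 * (s ^+ 2 * a n ^+ 2) * survival n)).
  rewrite /survival -massZ; apply: (le_mass kw) => x /andP[x0 xn].
  rewrite mulr1 /quad -mulrA ler_wpM2l // ler_pdivrMl ?exprn_gt0 //.
  apply: (@le_trans _ _ ((s * a n * x%:R) ^+ 2)).
    by rewrite ler_piMr ?sqr_ge0 // -expR0 ler_expR oppr_le0 !mulr_ge0 // ltW.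
  rewrite -!exprMn; apply: lerXn2r; rewrite ?nnegrE ?mulr_ge0 // ?(ltW an) //.
  by rewrite mulrC ler_wpM2r ?ler_nat // mulr_ge0 // ltW.
rewrite ler_piMr ?(survival_le1 kw nrm) //.
exact: mulr_ge0 C20 (mulr_ge0 (sqr_ge0 _) (sqr_ge0 _)).
Qed.

Lemma sum_head_tail (F P Q : nat -> R) k n0 N :
  (forall n, 0 <= P n) -> (forall n, 0 <= Q n) ->
  (forall n, (k <= n)%N -> (n < n0)%N -> F n <= P n) ->
  (forall n, (k <= n)%N -> (n0 <= n)%N -> F n <= Q n) ->
  \sum_(k <= n < N) F n <= \sum_(0 <= n < n0) P n + \sum_(n0 <= n < N) Q n.
Proof.
move=> P0 Q0 FP FQ; pose G n := if (n < n0)%N then P n else Q n.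
have G0 n : 0 <= G n by rewrite /G; case: ifP.
have FG : \sum_(k <= n < N) F n <= \sum_(0 <= n < N) G n.
  apply: (@le_trans _ _ (\sum_(k <= n < N) G n)).
    apply: ler_sum_nat => n /andP[kn _]; rewrite /G; case: ltnP => ?; [exact: FP|exact: FQ].
  have [kN|Nk] := leqP k N; last by rewrite [leLHS]big_geq ?sumr_ge0 // ltnW.
  by rewrite (@big_cat_nat _ _ _ k 0 N) //= lerDr sumr_ge0.
apply: (le_trans FG); have [Nn|nN] := leqP N n0.
  rewrite [X in _ + X]big_geq // addr0 (@big_cat_nat _ _ _ N 0 n0) //=.
  have -> : \sum_(0 <= n < N) G n = \sum_(0 <= n < N) P n.
    by apply: eq_big_nat => n /andP[_ nN]; rewrite /G (leq_trans nN).
  by rewrite lerDl sumr_ge0.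
have n0N := ltnW nN; rewrite (@big_cat_nat _ _ _ n0 0 N) //=.
rewrite le_eqVlt; apply/orP; left; apply/eqP; congr (_ + _); apply: eq_big_nat => n.
  by move=> /andP[_ nn0]; rewrite /G nn0.
by move=> /andP[n0n _]; rewrite /G ltnNge n0n.
Qed.

Lemma sum_inv_sqr_tail n0 N : (0 < n0)%N ->
  \sum_(n0 <= n < N) (n%:R ^+ 2)^-1 <= 2 / n0%:R :> R.
Proof.
move=> n00; have [n0N|Nn0] := leqP n0 N; last first.
  by rewrite big_geq ?divr_ge0 // ltnW.
apply: (@le_trans _ _ (\sum_(n0 <= n < N) (- (2 / n.+1%:R) - - (2 / n%:R)))).
  apply: ler_sum_nat => n /andP[n0n _].
  have n1 : 1 <= n%:R :> R by rewrite (ler_nat R 1) (leq_trans n00).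
  rewrite -[n.+1%:R]natr1; move: (n%:R : R) n1 => z z1.
  have -> : - (2 / (z + 1)) - - (2 / z) = (z ^+ 2)^-1 * (2 * z / (z + 1)).
    by field; lra.
  rewrite ler_peMr ?invr_ge0 ?sqr_ge0 // ler_pdivlMr; lra.
by rewrite telescope_sumr // opprK addrC gerDl oppr_le0 divr_ge0.
Qed.

(** The terms [n >= n0] contribute [s] times the tail of a convergent series, and
    the finitely many others [O (s ^ 2)]. *)
Lemma sum_quadratic_defect (M eps : R) : 0 <= M -> 0 < eps ->
  \forall s \near 0^'+, forall N,
    \sum_(m <= n < N) Num.min (s * M / n%:R ^+ 2) (s ^+ 2 * a n ^+ 2) <= eps * s.
Proof.
move=> M0 eps0.
have [n0 n0P] : exists n0, (0 < n0)%N /\ M * (2 / n0%:R) <= eps / 2.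
  exists (Num.truncn (4 * M / eps)).+1; split=> //.
  have := truncnS_gt (4 * M / eps); set z := (Num.truncn _).+1%:R => zM.
  have z0 : 0 < z by rewrite ltr0n.
  rewrite mulrA ler_pdivrMr //; move: zM; rewrite ltr_pdivrMr //; lra.
have [n00 n0e] := n0P.
pose K := \sum_(0 <= n < n0) a n ^+ 2.
have K0 : 0 <= K by apply: sumr_ge0 => n _; exact: sqr_ge0.
near=> s => N; have s0 : 0 < s by near: s; exact: nbhs_right_gt.
have sK : s * K <= eps / 2.
  apply: (@le_trans _ _ (s * (K + 1))); first by rewrite ler_pM2l // lerDl.
  rewrite -ler_pdivlMr; last by rewrite ltr_wpDl.
  by near: s; apply: nbhs_right_le; rewrite !divr_gt0 // ltr_wpDl.
apply: le_trans (@sum_head_tail _ (fun n => s ^+ 2 * a n ^+ 2)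
  (fun n => s * M / n%:R ^+ 2) _ n0 _ _ _ _ _) _ => [n|n|n _ _|n _ _|].
- by rewrite mulr_ge0 ?sqr_ge0.
- by rewrite divr_ge0 ?sqr_ge0 // mulr_ge0 // ltW.
- by rewrite ge_min lexx orbT.
- by rewrite ge_min lexx.
have -> : \sum_(0 <= n < n0) s ^+ 2 * a n ^+ 2 = s * (s * K).
  by rewrite mulrA -expr2 /K mulr_sumr.
have tail : \sum_(n0 <= n < N) s * M / n%:R ^+ 2 <= s * (M * (2 / n0%:R)).
  rewrite -mulr_sumr -mulrA ler_pM2l // ler_wpM2l //.
  exact: sum_inv_sqr_tail.
apply: le_trans (lerD (lexx _) tail) _; rewrite -mulrDr mulrC ler_pM2r //.
by rewrite -[leRHS]mulr1; apply: le_trans (lerD sK n0e) _; lra.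
Unshelve. all: by end_near. Qed.

(** With [X n = g * s ^ 2 * A n / 2], the sum of [(s * a n.+1) ^ 2] against
    [expR (- X n.+1)] is bounded by a telescoping sum. Up to a constant, [exp_clock s n]
    is at most the square of [expR (- X n.+1)], and the second copy of this factor
    has to make the remaining [p = s * a n.+1] small: one has
    [p <= delta + p ^ 2 / delta], and [p ^ 2] is [O (X n.+1 / n)]. *)
Lemma sum_quartic_defect nrm (eps : R) : (0 < m)%N -> 0 < eps ->
  \forall s \near 0^'+, forall N,
    \sum_(m <= n < N) exp_clock s n * (s * a n.+1) ^+ 3 <= eps.
Proof.
move=> m0 eps0; have [alpha_gtN1 alpha_le_half a_gt0 aS] := nrm.
have C0 : 0 <= C by rewrite divr_ge0 //; lra.
have C20 : 0 <= C ^+ 2 by exact: sqr_ge0.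
pose A := sum_sqr a; pose E0 := expR (A m / 2); have E00 : 0 < E0 := expR_gt0 _.
pose g := (2 * (1 + C ^+ 2))^-1.
have g0 : 0 < g by rewrite invr_gt0; lra.
have gE : g * (1 + C ^+ 2) = 1 / 2 by rewrite /g; field; lra.
have A0 n : 0 <= A n by apply: sumr_ge0 => i _; exact: sqr_ge0.
have AS n : (0 < n)%N -> g * A n.+1 <= A n / 2.
  move=> n0; have -> : A n / 2 = g * (A n + C ^+ 2 * A n).
    by rewrite -[X in _ * (X + _)]mul1r -mulrDl mulrA gE; field.
  rewrite ler_pM2l // /A sum_sqrS lerD2l.
  apply: (@le_trans _ _ (C ^+ 2 * a n ^+ 2)).
    rewrite -exprMn; apply: lerXn2r; rewrite ?nnegrE ?(ltW (a_gt0 _ _)) //.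
      exact: mulr_ge0 C0 (ltW (a_gt0 _ n0)).
    exact: (a_step_le nrm).
  rewrite ler_wpM2l // /sum_sqr big_nat_recr //= lerDr.
  by apply: sumr_ge0 => i _; exact: sqr_ge0.
pose delta := g * eps / (8 * E0).
have delta0 : 0 < delta by rewrite divr_gt0 ?mulr_gt0.
have [n0 n0P] : exists n0, 6 / (g * delta) / n0.+1%:R <= delta.
  exists (Num.truncn (6 / (g * delta) / delta)).
  have := truncnS_gt (6 / (g * delta) / delta); set z := (Num.truncn _).+1%:R => zM.
  have z0 : 0 < z by rewrite ltr0n.
  by rewrite ler_pdivrMr // [leRHS]mulrC -ler_pdivrMr // ltW.
pose K := \sum_(0 <= n < n0) a n.+1 ^+ 3.
have K0 : 0 <= K by apply: sumr_ge0 => n _; rewrite exprn_ge0 // ltW // a_gt0.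
near=> s => N; have s0 : 0 < s by near: s; exact: nbhs_right_gt.
have s1 : s <= 1 by near: s; exact: nbhs_right_le.
have sK : s * K <= eps / 2.
  apply: (@le_trans _ _ (s * (K + 1))); first by rewrite ler_pM2l // lerDl.
  rewrite -ler_pdivlMr; last by rewrite ltr_wpDl.
  by near: s; apply: nbhs_right_le; rewrite !divr_gt0 // ltr_wpDl.
pose X n := g * s ^+ 2 * A n / 2.
have X0 n : 0 <= X n.
  by rewrite /X divr_ge0 // mulr_ge0 // mulr_ge0 ?sqr_ge0 // ltW.
have XS n : X n.+1 = X n + g / 2 * (s * a n.+1) ^+ 2.
  by rewrite /X /A sum_sqrS; field.
have dX n : g / 2 * (s * a n.+1) ^+ 2 * expR (- X n.+1) <= expR (- X n) - expR (- X n.+1).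
  rewrite XS; move: (_ * _ ^+ 2) => D.
  have -> : expR (- X n) = expR D * expR (- (X n + D)) by rewrite -expRD; congr expR; ring.
  have e0 := expR_ge0 (- (X n + D)).
  have := ler_wpM2r e0 (expR_ge1Dx D); lra.
have tail n : (m <= n)%N -> (n0 <= n)%N ->
    exp_clock s n * (s * a n.+1) ^+ 3 <= eps / 2 * (expR (- X n) - expR (- X n.+1)).
  move=> mn n0n; have n_gt0 : (0 < n)%N by exact: leq_trans mn.
  set p := s * a n.+1; have p0 : 0 <= p by rewrite mulr_ge0 // ltW // a_gt0.
  have e_le : exp_clock s n <= E0 * (expR (- X n.+1) * expR (- X n.+1)).
    rewrite /exp_clock /E0 -!expRD ler_expR /clock -/A.
    have s21 : s ^+ 2 <= 1 by rewrite -(expr1n R 2) lerXn2r ?nnegrE // ltW.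
    have h1 := ler_wpM2l (sqr_ge0 s) (AS n n_gt0).
    have h2 := ler_wpM2r (A0 m) s21.
    by rewrite /X; lra.
  have Xe : X n.+1 * expR (- X n.+1) <= 1.
    rewrite expRN ler_pdivrMr ?expR_gt0 // mul1r.
    by apply: le_trans (expR_ge1Dx _); lra.
  have p2e : p ^+ 2 / delta * expR (- X n.+1) <= delta.
    apply: le_trans n0P; rewrite -mulrA (mulrC delta^-1) mulrA ler_pdivrMr //.
    apply: (@le_trans _ _ (6 / g / n.+1%:R)); last first.
      have -> : 6 / (g * delta) / n0.+1%:R * delta = 6 / g * n0.+1%:R^-1.
        by move: (n0.+1%:R^-1) => z; field; rewrite !gt_eqF.
      apply: ler_wpM2l; first by rewrite divr_ge0 // ltW.
      by rewrite lef_pV2 ?posrE ?ltr0n // ler_nat ltnS.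
    rewrite ler_pdivlMr ?ltr0n // ler_pdivlMr //.
    apply: (@le_trans _ _ (6 * (X n.+1 * expR (- X n.+1)))); last lra.
    have h := ler_wpM2l (mulr_ge0 (ltW g0) (sqr_ge0 s)) (natr_sqr_le_sum nrm (ltn0Sn n)).
    have -> : p ^+ 2 * expR (- X n.+1) * n.+1%:R * g =
        g * s ^+ 2 * (n.+1%:R * a n.+1 ^+ 2) * expR (- X n.+1) by rewrite /p; ring.
    have -> : 6 * (X n.+1 * expR (- X n.+1)) =
        g * s ^+ 2 * (3 * A n.+1) * expR (- X n.+1) by rewrite /X; field.
    by rewrite ler_wpM2r ?expR_ge0.
  have pd : p <= delta + p ^+ 2 / delta.
    have -> : delta + p ^+ 2 / delta = (delta ^+ 2 + p ^+ 2) / delta.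
      by field; rewrite gt_eqF.
    rewrite ler_pdivlMr //.
    by have := sqr_ge0 (p - delta); have := mulr_ge0 p0 (ltW delta0); lra.
  have eX1 : expR (- X n.+1) <= 1 by rewrite -expR0 ler_expR oppr_le0.
  have e0 := expR_ge0 (- X n.+1).
  have pe : p * expR (- X n.+1) <= 2 * delta.
    apply: le_trans (ler_wpM2r e0 pd) _; rewrite mulrDl.
    have := ler_wpM2l (ltW delta0) eX1; lra.
  apply: (@le_trans _ _ (E0 * (2 * delta) * (p ^+ 2 * expR (- X n.+1)))).
    apply: le_trans (ler_wpM2r (exprn_ge0 3 p0) e_le) _.
    have -> : E0 * (expR (- X n.+1) * expR (- X n.+1)) * p ^+ 3 =
      E0 * (p * expR (- X n.+1)) * (p ^+ 2 * expR (- X n.+1)) by ring.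
    apply: ler_wpM2r; first by rewrite mulr_ge0 ?sqr_ge0.
    by apply: ler_wpM2l; [exact: ltW|exact: pe].
  have -> : E0 * (2 * delta) * (p ^+ 2 * expR (- X n.+1)) =
      eps / 2 * (g / 2 * p ^+ 2 * expR (- X n.+1)).
    by rewrite /delta; field; rewrite gt_eqF.
  by apply: ler_wpM2l (dX n); rewrite divr_ge0 // ltW.
have D0 n : 0 <= expR (- X n) - expR (- X n.+1).
  apply: le_trans (dX n); rewrite mulr_ge0 ?expR_ge0 // mulr_ge0 ?sqr_ge0 //.
  by rewrite divr_ge0 // ltW.
apply: le_trans (@sum_head_tail _ (fun n => (s * a n.+1) ^+ 3)
  (fun n => eps / 2 * (expR (- X n) - expR (- X n.+1))) _ n0 _ _ _ _ _) _ => [n|n|n mn _|n|].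
- by rewrite exprn_ge0 // mulr_ge0 // ltW // a_gt0.
- by rewrite mulr_ge0 // divr_ge0 // ltW.
- rewrite ler_piMl ?exp_clock_le1 // exprn_ge0 // mulr_ge0 // ltW //; exact: a_gt0.
- exact: tail.
have -> : \sum_(0 <= n < n0) (s * a n.+1) ^+ 3 = s ^+ 2 * (s * K).
  by rewrite /K !mulr_sumr; apply: eq_bigr => n _; ring.
have tele : \sum_(n0 <= n < N) (expR (- X n) - expR (- X n.+1)) <= 1.
  have [n0N|Nn0] := leqP n0 N; last by rewrite big_geq // ltnW.
  under eq_bigr => n _ do rewrite -[expR (- X n) - _]opprB.
  rewrite sumrN telescope_sumr // opprB.
  have : expR (- X n0) <= 1 by rewrite -expR0 ler_expR oppr_le0.
  have := expR_ge0 (- X N); lra.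
rewrite -mulr_sumr.
have : eps / 2 * \sum_(n0 <= n < N) (expR (- X n) - expR (- X n.+1)) <= eps / 2.
  by rewrite ler_piMr // divr_ge0 // ltW.
have : s ^+ 2 * (s * K) <= eps / 2.
  have sK0 : 0 <= s * K by rewrite mulr_ge0 // ltW.
  by apply: le_trans sK; apply: ler_piMl sK0 _; rewrite expr_le1 // ltW.
lra.
Unshelve. all: by end_near. Qed.

(** Together with [laplace_sum_ge] this says that the Laplace transform of the
    survival probability along the clock is [a m * y * s] up to [o (s)], where
    [s ^ 2 / 2] is the Laplace variable; the error is the total defect. *)
Lemma laplace_sum_le kw nrm (eps : R) : 0 < eps ->
  \forall s \near 0^'+, forall N, (m <= N)%N ->
    laplace_sum s N <= (a m * y%:R + eps) * s.
Proof.
move=> eps0; have [alpha_gtN1 alpha_le_half a_gt0 aS] := nrm.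
have m0 := killed_m_gt0 kw.
have M0 : 0 <= a m * y%:R by rewrite mulr_ge0 // ltW // a_gt0.
have C0 : 0 <= C by rewrite divr_ge0 //; lra.
have C20 : 0 <= C ^+ 2 by exact: sqr_ge0.
pose e1 := eps / 2 / (C ^+ 2 + 1); pose e2 := eps / 2 / (C * (a m * y%:R) + 1).
have CM0 : 0 <= C * (a m * y%:R) by exact: mulr_ge0.
have e10 : 0 < e1 by rewrite !divr_gt0 // ltr_wpDl.
have e20 : 0 < e2 by rewrite !divr_gt0 // ltr_wpDl.
have quad := sum_quadratic_defect M0 e10.
have quart := sum_quartic_defect nrm m0 e20.
near=> s; have s0 : 0 < s by near: s; exact: nbhs_right_gt.
have quad_s : forall N,
    \sum_(m <= n < N) Num.min (s * (a m * y%:R) / n%:R ^+ 2) (s ^+ 2 * a n ^+ 2) <= e1 * s.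
  by near: s.
have quart_s : forall N, \sum_(m <= n < N) exp_clock s n * (s * a n.+1) ^+ 3 <= e2.
  by near: s.
move=> N mN.
rewrite (laplace_sumE kw) //.
have u_le0 : mass w N (exp_walk s N) - exp_clock s N * survival N <= 0.
  rewrite subr_le0 /survival -massZ; apply: (le_mass kw) => x _.
  rewrite mulr1 ler_piMl ?expR_ge0 // -expR0 ler_expR oppr_le0 !mulr_ge0 // ltW //.
  by apply: a_gt0; exact: leq_trans mN.
have exp_le : 1 - expR (- (s * a m * y%:R)) <= s * (a m * y%:R).
  by rewrite lerBlDr -lerBlDl; apply: le_trans (expR_ge1Dx _); rewrite mulrA.
have def_le : \sum_(m <= n < N) mass w n (defect s n) <= eps * s.
  apply: le_trans (ler_sum_nat (fun n mnN => mass_defect_le kw nrm (ltW s0) (proj1 (andP mnN)))) _.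
  rewrite big_split /= -!mulr_sumr.
  have frac c : 0 <= c -> c * (eps / 2 / (c + 1)) <= eps / 2.
    move=> c0; rewrite mulrA ler_pdivrMr ?ltr_wpDl // mulrDr mulr1 mulrC lerDl.
    by rewrite divr_ge0 // ltW.
  have h1 : C ^+ 2 * (e1 * s) <= eps / 2 * s.
    by rewrite mulrA; apply: ler_wpM2r; [exact: ltW|exact: frac].
  have h2 : C * (a m * y%:R) * s * e2 <= eps / 2 * s.
    by rewrite mulrAC; apply: ler_wpM2r; [exact: ltW|exact: frac].
  have q1 : C ^+ 2 * \sum_(m <= n < N) Num.min (s * (a m * y%:R) / n%:R ^+ 2) (s ^+ 2 * a n ^+ 2)
      <= C ^+ 2 * (e1 * s).
    by apply: ler_wpM2l (quad_s N).
  have q2 : C * (a m * y%:R) * s * \sum_(m <= n < N) exp_clock s n * (s * a n.+1) ^+ 3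
      <= C * (a m * y%:R) * s * e2.
    by apply: ler_wpM2l (quart_s N); rewrite mulr_ge0 // ltW.
  lra.
by rewrite mulrDl (mulrC (a m * _)); lra.
Unshelve. all: by end_near. Qed.

Lemma laplace_sum_ge kw nrm (s : R) N : 0 <= s -> (m <= N)%N ->
  1 - expR (- (s * a m * y%:R)) - exp_clock s N <= laplace_sum s N.
Proof.
move=> s0 mN; rewrite (laplace_sumE kw) //.
have def0 : 0 <= \sum_(m <= n < N) mass w n (defect s n).
  rewrite big_seq_cond; apply: sumr_ge0 => n /andP[]; rewrite mem_index_iota => /andP[mn _] _.
  by apply: (mass_ge0 kw) => x xn; have /andP[] := defect_bounds nrm s0 xn.
have H0 : 0 <= mass w N (exp_walk s N).
  by apply: (mass_ge0 kw) => x _; rewrite mulr_ge0 ?expR_ge0.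
have : exp_clock s N * survival N <= exp_clock s N.
  by rewrite ler_piMr ?expR_ge0 // (survival_le1 kw nrm).
lra.
Qed.

End Walk.
End KilledWalk.

(** * Exponential kernels *)
Section ExponentialKernels.
Context (R : realType).
Implicit Types (Q : {poly R}) (u v x : R).

(** A polynomial without constant term in [expR (- u)]. Its integral up to
    [u], its integral over the half line, and its integral over the half line with
    the weight [(pi * u) ^ (- 1 / 2)] are finite sums over the coefficients; the
    three definitions below are these sums. *)
Definition kernel Q u := Q.[expR (- u)] * expR (- u).

Definition kernel_cdf Q u := \sum_(i < size Q) Q`_i / i.+1%:R * (1 - expR (- (i.+1%:R * u))).

Definition kernel_total Q := \sum_(i < size Q) Q`_i / i.+1%:R.

Definition kernel_half Q := \sum_(i < size Q) Q`_i / Num.sqrt i.+1%:R.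

Lemma kernel_cdf0 Q : kernel_cdf Q 0 = 0.
Proof.
by rewrite /kernel_cdf big1 // => i _; rewrite mulr0 oppr0 expR0 subrr mulr0.
Qed.

Lemma is_derive_kernel_cdf Q u : is_derive u (1 : R) (kernel_cdf Q) (kernel Q u).
Proof.
rewrite /kernel horner_coef mulr_suml.
have -> : kernel_cdf Q = \sum_(i < size Q)
    (fun u => Q`_i / i.+1%:R * (1 - expR (- (i.+1%:R * u)))).
  by apply/funext => v; rewrite fct_sumE.
apply: is_derive_sum => i.
apply: is_derive_eq; rewrite /GRing.scale /= -mulrA -exprSr -expRM_natl.
have k0 : i.+1%:R != 0 :> R by rewrite pnatr_eq0.
rewrite (mulrN i.+1%:R u); set e := expR _; move: e => e.
by move: (i.+1%:R : R) k0 => k k0; field.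
Qed.

Lemma kernel_cdf_le Q1 Q2 a b : a <= b ->
  (forall u, a <= u <= b -> kernel Q1 u <= kernel Q2 u) ->
  kernel_cdf Q1 b - kernel_cdf Q1 a <= kernel_cdf Q2 b - kernel_cdf Q2 a.
Proof.
move=> ab Q12; pose f u := kernel_cdf Q2 u - kernel_cdf Q1 u.
have df u : is_derive u (1 : R) f (kernel Q2 u - kernel Q1 u).
  by apply: is_deriveB; exact: is_derive_kernel_cdf.
have [|c /itvP cin] := @MVT_segment R f (fun u => kernel Q2 u - kernel Q1 u) a b ab (fun x _ => df x).
  by apply: continuous_subspaceT => x; apply/differentiable_continuous/derivable1_diffP;
     have [] := df x.
rewrite /f => E; have := mulr_ge0 (_ : 0 <= kernel Q2 c - kernel Q1 c) (_ : 0 <= b - a).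
rewrite -E !subr_ge0 => /(_ _ ab); rewrite Q12 ?cin // => /(_ isT); lra.
Qed.

Lemma cvg_kernel_cdf Q : kernel_cdf Q u @[u --> +oo] --> kernel_total Q.
Proof.
have -> : kernel_total Q = \sum_(i < size Q) Q`_i / i.+1%:R * (1 - 0).
  by apply: eq_bigr => i _; rewrite subr0 mulr1.
apply: cvg_big => [|i _]; first exact: add_continuous.
apply: cvgM; first exact: cvg_cst.
apply: cvgB; first exact: cvg_cst.
have k0 : 0 < i.+1%:R :> R by rewrite ltr0n.
apply: (cvg_comp (fun u : R => i.+1%:R * u) (fun v : R => expR (- v)));
  last exact: cvgr_expR.
by apply: gt0_cvgMry => //; exact: cvg_id.
Qed.

End ExponentialKernels.

(** The primitive is started at [-1] because the fundamental theorem of calculus is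
    needed at [0] itself. *)
Lemma gauss_primitive (R : realType) : exists G : R -> R,
  [/\ forall v : R, 0 <= v -> is_derive v (1 : R) G (expR (- v ^+ 2)), G 0 = 0 &
      G v @[v --> +oo] --> Num.sqrt pi / 2].
Proof.
have gint (A : set R) : measurable A -> (@lebesgue_measure R).-integrable A (EFin \o gauss_fun).
  by move=> mA; apply: integrableS (@integrableT_gauss R).
pose F (v : R) := \int[@lebesgue_measure R]_(t in `[-1, v]) gauss_fun t.
exists (fun v => F v - F 0); split; last 2 first.
- by rewrite subrr.
- have FE (v : R) : 0 <= v -> F v - F 0 = gauss_integral_proof.integral0_gauss v.
    have N10 : -1 <= 0 :> R by rewrite lerN10.
    move=> v0; have := @Rintegral_itvB R gauss_fun (BLeft (-1)) (BRight v) 0 (gint _ (measurable_itv _)).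
    rewrite !bnd_simp => /(_ N10 v0) ->.
    by rewrite Rintegral_itv_obnd_cbnd //; exact: gint.
  have : Num.sqrt (@gauss_integral_proof.integral0_gauss R x ^+ 2) @[x --> +oo]
      --> Num.sqrt (pi / 4).
    apply: continuous_cvg; first exact: sqrt_continuous.
    exact: gauss_integral_proof.cvg_integral0_gauss_sqr.
  have -> : Num.sqrt (pi / 4) = Num.sqrt pi / 2 :> R.
    rewrite sqrtrM ?pi_ge0 // sqrtrV // (_ : 4 = 2 ^+ 2); last by rewrite expr2 -natrM.
    by rewrite sqrtr_sqr ger0_norm.
  apply: cvg_trans; apply: near_eq_cvg; near=> v.
  have v0 : 0 <= v by near: v; apply: nbhs_pinfty_ge; exact: num_real.
  by rewrite FE // sqrtr_sqr ger0_norm // gauss_integral_proof.integral0_gauss_ge0.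
move=> v v0; have FF : is_derive v (1 : R) F (expR (- v ^+ 2)).
  have [||||dF FE] := @continuous_FTC1_closed R gauss_fun (-1) v (v + 1).
  - by rewrite ltrDl.
  - exact: gint.
  - by apply: lt_le_trans v0; rewrite ltrN10.
  - exact: continuous_gauss_fun.
  by rewrite derive1E in FE; exact: (DeriveDef dF FE).
by apply: is_derive_eq; rewrite subr0.
Unshelve. all: by end_near. Qed.

(** The right-hand side is the integral over [v >= 0] of
    [2 * (kernel Q1 (v ^ 2) + v * kernel Q2 (v ^ 2))], because the integral of
    [expR (- (k * v ^ 2))] is [Num.sqrt (pi / k) / 2]. Through the substitution
    [u = v ^ 2], it compares integrals with the weight [u ^ (- 1 / 2)] and
    integrals without weight. *)
Lemma kernel_positivity (R : realType) (Q1 Q2 : {poly R}) :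
  (forall v, 0 <= v -> 0 <= kernel Q1 (v ^+ 2) + v * kernel Q2 (v ^+ 2)) ->
  0 <= Num.sqrt pi * kernel_half Q1 + kernel_total Q2.
Proof.
move=> pos; have [G [dG G0 Ginfty]] := gauss_primitive R.
pose r (i : nat) : R := Num.sqrt i.+1%:R.
have r0 i : 0 < r i by rewrite sqrtr_gt0 ltr0n.
have rr i : r i ^+ 2 = i.+1%:R by rewrite sqr_sqrtr.
pose H1 (v : R) := \sum_(i < size Q1) 2 * Q1`_i / r i * G (r i * v).
pose H v := H1 v + kernel_cdf Q2 (v ^+ 2).
have dH1 (v : R) : 0 <= v -> is_derive v (1 : R) H1 (2 * kernel Q1 (v ^+ 2)).
  move=> v0; rewrite /kernel horner_coef mulr_suml mulr_sumr.
  have -> : H1 = \sum_(i < size Q1) (fun v => 2 * Q1`_i / r i * G (r i * v)).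
    by apply/funext => u; rewrite fct_sumE.
  apply: is_derive_sum => i.
  have dGi : is_derive (r i * v) (1 : R) G (expR (- (r i * v) ^+ 2)).
    by apply: dG; rewrite mulr_ge0 // ltW.
  have dri : is_derive v (1 : R) (fun u : R => r i * u) (r i).
    by apply: is_derive_eq; rewrite /GRing.scale /= mulr1.
  have dGr := @is_derive1_comp R G (fun u : R => r i * u) v _ _ dGi dri.
  have -> : 2 * (Q1`_i * expR (- v ^+ 2) ^+ i * expR (- v ^+ 2)) =
      2 * Q1`_i / r i * (expR (- (r i * v) ^+ 2) * r i).
    rewrite -mulrA -exprSr -expRM_natl exprMn rr (mulrN i.+1%:R).
    by move: (expR _) (r i) (r0 i) => e k k0; field; rewrite gt_eqF.
  exact: (is_deriveZ (2 * Q1`_i / r i) dGr).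
have dH (v : R) : 0 <= v ->
    is_derive v (1 : R) H (2 * (kernel Q1 (v ^+ 2) + v * kernel Q2 (v ^+ 2))).
  move=> v0; have dsq : is_derive v (1 : R) (fun u : R => u ^+ 2) (2 * v).
    by apply: is_derive_eq; rewrite /GRing.scale /=; ring.
  have dK := @is_derive1_comp R (kernel_cdf Q2) (fun u : R => u ^+ 2) v _ _
    (is_derive_kernel_cdf Q2 (v ^+ 2)) dsq.
  have -> : 2 * (kernel Q1 (v ^+ 2) + v * kernel Q2 (v ^+ 2)) =
    2 * kernel Q1 (v ^+ 2) + kernel Q2 (v ^+ 2) * (2 * v) by ring.
  exact: (is_deriveD (dH1 v v0) dK).
have H0 : H 0 = 0.
  rewrite /H expr0n /= kernel_cdf0 addr0 /H1 big1 // => i _.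
  by rewrite mulr0 G0 mulr0.
have Hinfty : H v @[v --> +oo] --> Num.sqrt pi * kernel_half Q1 + kernel_total Q2.
  apply: cvgD; last first.
    by apply: (cvg_comp (fun v : R => v ^+ 2)); [exact: cvgr_expr2|exact: cvg_kernel_cdf].
  have -> : Num.sqrt pi * kernel_half Q1 =
      \sum_(i < size Q1) 2 * Q1`_i / r i * (Num.sqrt pi / 2) :> R.
    by rewrite /kernel_half mulr_sumr; apply: eq_bigr => i _; rewrite -/(r i); field; rewrite gt_eqF.
  apply: cvg_big => [|i _]; first exact: add_continuous.
  apply: cvgM; first exact: cvg_cst.
  apply: (cvg_comp (fun v : R => r i * v)); last exact: Ginfty.
  by apply: gt0_cvgMry => //; exact: cvg_id.
rewrite -(cvg_lim (@Rhausdorff R) Hinfty).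
apply: limr_ge; first by apply/cvg_ex; eexists; exact: Hinfty.
near=> v; rewrite -H0.
apply: (@derive_ge0_ge_start R H (fun v => 2 * (kernel Q1 (v ^+ 2) + v * kernel Q2 (v ^+ 2)))) => //.
  by move=> u u0; rewrite mulr_ge0 // pos.
Unshelve. all: by end_near. Qed.

(** * From Laplace transforms to kernel sums *)
Section Tauberian.
Context (R : realType) (b t : nat -> R) (c : R).

Definition laplace_increments (lam : R) (N : nat) : R :=
  \sum_(0 <= k < N) b k * (expR (- (lam * t k)) - expR (- (lam * t k.+1))).

(** The asymptotics concerns all sufficiently long partial sums, so that no series
    has to be summed. *)
Record sqrt_laplace : Prop := {
  sqlap_b_ge0 : forall k, 0 <= b k;
  sqlap_b_noninc : forall k, b k.+1 <= b k;
  sqlap_t0 : t 0%N = 0;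
  sqlap_t_nondec : forall k, t k <= t k.+1;
  sqlap_t_cvgy : t k @[k --> \oo] --> +oo;
  sqlap_c_ge0 : 0 <= c;
  sqlap_asym : forall eps : R, 0 < eps -> exists2 d : R, 0 < d &
    forall lam, 0 < lam < d -> exists N0 : nat, forall N, (N0 <= N)%N ->
      `|laplace_increments lam N - c * Num.sqrt lam| <= eps * Num.sqrt lam
}.

(** Riemann-Stieltjes sums of [b], as a function of [lam * t], against the kernel. *)
Definition kernel_sum (Q : {poly R}) (lam : R) (N : nat) : R :=
  \sum_(0 <= k < N) b k * (kernel_cdf Q (lam * t k.+1) - kernel_cdf Q (lam * t k)).

Lemma kernel_sumE Q lam N : kernel_sum Q lam N =
  \sum_(i < size Q) Q`_i / i.+1%:R * laplace_increments (i.+1%:R * lam) N.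
Proof.
rewrite /laplace_increments; under [RHS]eq_bigr do rewrite mulr_sumr.
rewrite exchange_big /=; apply: eq_bigr => k _.
rewrite /kernel_cdf -sumrB mulr_sumr; apply: eq_bigr => i _.
by rewrite -!mulrA; ring.
Qed.

(** Linear combinations of the hypothesis at [lam], [2 * lam], [3 * lam] and so on. *)
Lemma kernel_sum_asym Q (eps : R) : sqrt_laplace -> 0 < eps ->
  exists2 d : R, 0 < d & forall lam, 0 < lam < d -> exists N0 : nat, forall N, (N0 <= N)%N ->
    `|kernel_sum Q lam N - c * Num.sqrt lam * kernel_half Q| <= eps * Num.sqrt lam.
Proof.
move=> H eps0; pose M := \sum_(i < size Q) `|Q`_i|.
have M0 : 0 <= M by apply: sumr_ge0.
have M1 : 0 < M + 1 by rewrite ltr_wpDl.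
pose e := eps / (M + 1); have e0 : 0 < e by rewrite divr_gt0.
have [d d0 dP] := sqlap_asym H e0.
have n0 : 0 < (size Q).+1%:R :> R by rewrite ltr0n.
exists (d / (size Q).+1%:R); first by rewrite divr_gt0.
move=> lam /andP[lam0 lamd].
have iP (i : 'I_(size Q)) : exists N0 : nat, forall N, (N0 <= N)%N ->
    `|laplace_increments (i.+1%:R * lam) N - c * Num.sqrt (i.+1%:R * lam)|
      <= e * Num.sqrt (i.+1%:R * lam).
  apply: dP; rewrite mulr_gt0 ?ltr0n //=.
  move: lamd; rewrite ltr_pdivlMr // mulrC; apply: le_lt_trans.
  by apply: ler_wpM2r; [exact: ltW|rewrite ler_nat ltnS ltnW // ltn_ord].
have [N0 N0P] := choice iP.
exists (\max_i N0 i)%N => N NN0.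
rewrite kernel_sumE /kernel_half mulr_sumr -sumrB.
apply: le_trans (ler_norm_sum _ _ _) _.
apply: (@le_trans _ _ (\sum_(i < size Q) `|Q`_i| * (e * Num.sqrt lam))).
  apply: ler_sum => i _; pose r : R := Num.sqrt i.+1%:R.
  have r0 : 0 < r by rewrite sqrtr_gt0 ltr0n.
  have rr : i.+1%:R = r ^+ 2 by rewrite sqr_sqrtr.
  have r1 : 1 <= r by rewrite -sqrtr1 ler_wsqrtr // (ler_nat R 1).
  have := N0P i N (leq_trans (leq_bigmax i) NN0).
  rewrite sqrtrM // -/r => le_i.
  have -> : Q`_i / i.+1%:R * laplace_increments (i.+1%:R * lam) N -
      c * Num.sqrt lam * (Q`_i / r) =
      Q`_i / r ^+ 2 * (laplace_increments (i.+1%:R * lam) N - c * (r * Num.sqrt lam)).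
    rewrite {1}rr; move: (laplace_increments _ _) => L; field; exact: lt0r_neq0.
  rewrite normrM normrM -mulrA ler_wpM2l // normfV (ger0_norm (sqr_ge0 r)).
  rewrite ler_pdivrMl ?exprn_gt0 //; apply: le_trans le_i _.
  rewrite mulrCA; apply: ler_wpM2r; first by rewrite mulr_ge0 // ltW.
  by rewrite expr2 ler_peMr // ltW.
rewrite -mulr_suml -/M mulrA ler_wpM2r // /e mulrCA ler_piMr ?ltW //.
by rewrite ltr_pdivrMr // mul1r ltrDl.
Qed.

Lemma nonincreasing_b k l : sqrt_laplace -> (k <= l)%N -> b l <= b k.
Proof.
by move=> H; apply: (@nonincreasing_seqP _ _ b).1; exact: (sqlap_b_noninc H).
Qed.

Lemma nondecreasing_t k l : sqrt_laplace -> (k <= l)%N -> t k <= t l.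
Proof.
by move=> H; apply: (@nondecreasing_seqP _ _ t).1; exact: (sqlap_t_nondec H).
Qed.

Lemma t_ge0 k : sqrt_laplace -> 0 <= t k.
Proof. by move=> H; rewrite -(sqlap_t0 H); apply: nondecreasing_t. Qed.

Lemma kernel_cdf_nondecreasing (Q : {poly R}) u v :
  (forall u, 0 <= u -> 0 <= kernel Q u) -> 0 <= u -> u <= v ->
  kernel_cdf Q u <= kernel_cdf Q v.
Proof.
move=> Q0 u0 uv; rewrite -subr_ge0.
have := @kernel_cdf_le R 0 Q u v uv _; rewrite {1 2}/kernel_cdf size_poly0 !big_ord0 subrr.
by apply=> w /andP[uw _]; rewrite /kernel horner0 mul0r Q0 // (le_trans u0).
Qed.

Lemma kernel_cdf_le_total (Q : {poly R}) u :
  (forall u, 0 <= u -> 0 <= kernel Q u) -> 0 <= u -> kernel_cdf Q u <= kernel_total Q.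
Proof.
move=> Q0 u0; rewrite -(cvg_lim (@Rhausdorff R) (@cvg_kernel_cdf R Q)).
apply: limr_ge; first by apply/cvg_ex; eexists; exact: (@cvg_kernel_cdf R Q).
near=> v; apply: kernel_cdf_nondecreasing => //.
Unshelve. all: by end_near. Qed.

(** As [b] is nonincreasing, it is at least [b k] on [[0, lam * t k]]. *)
Lemma kernel_sum_ge (Q : {poly R}) lam k N : sqrt_laplace ->
  (forall u, 0 <= u -> 0 <= kernel Q u) -> 0 <= lam -> (k <= N)%N ->
  b k * kernel_cdf Q (lam * t k) <= kernel_sum Q lam N.
Proof.
move=> H Q0 lam0 kN; have dK j : 0 <= kernel_cdf Q (lam * t j.+1) - kernel_cdf Q (lam * t j).
  rewrite subr_ge0; apply: kernel_cdf_nondecreasing => //.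
    by rewrite mulr_ge0 // t_ge0.
  by rewrite ler_wpM2l // (sqlap_t_nondec H).
rewrite /kernel_sum (@big_cat_nat _ _ _ k 0 N) //= -[leLHS]addr0; apply: lerD; last first.
  by apply: sumr_ge0 => j _; rewrite mulr_ge0 // (sqlap_b_ge0 H).
have -> : kernel_cdf Q (lam * t k) =
    \sum_(0 <= j < k) (kernel_cdf Q (lam * t j.+1) - kernel_cdf Q (lam * t j)).
  rewrite (telescope_sumr (fun j => kernel_cdf Q (lam * t j)) (leq0n k)).
  by rewrite (sqlap_t0 H) mulr0 kernel_cdf0 subr0.
rewrite mulr_sumr.
apply: ler_sum_nat => j /andP[_ jk]; apply: ler_wpM2r => //.
by apply: nonincreasing_b => //; exact: ltnW.
Qed.

(** Up to [lam * t k] the kernel is dominated by a small multiple of another one,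
    and from there on [b] is at most [b k]. *)
Lemma kernel_sum_le (Q Q1 : {poly R}) (r lam : R) k N : sqrt_laplace ->
  (forall u, 0 <= u -> 0 <= kernel Q u) -> (forall u, 0 <= u -> 0 <= kernel Q1 u) ->
  0 <= r -> 0 <= lam -> (k <= N)%N ->
  (forall u, 0 <= u <= lam * t k -> kernel Q u <= r * kernel Q1 u) ->
  kernel_sum Q lam N <= r * kernel_sum Q1 lam N + b k * kernel_total Q.
Proof.
move=> H Q0 Q10 r0 lam0 kN QQ1.
have lt0 j : 0 <= lam * t j by rewrite mulr_ge0 // t_ge0.
have ltS j : lam * t j <= lam * t j.+1 by rewrite ler_wpM2l // (sqlap_t_nondec H).
rewrite /kernel_sum (@big_cat_nat _ _ _ k 0 N) //=; apply: lerD.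
  rewrite mulr_sumr (@big_cat_nat _ _ _ k 0 N) //= -[leLHS]addr0; apply: lerD; last first.
    apply: sumr_ge0 => j _; rewrite mulr_ge0 // mulr_ge0 ?(sqlap_b_ge0 H) // subr_ge0.
    exact: kernel_cdf_nondecreasing.
  apply: ler_sum_nat => j /andP[_ jk]; rewrite mulrCA; apply: ler_wpM2l.
    exact: (sqlap_b_ge0 H).
  have cdfZ u : r * kernel_cdf Q1 u = kernel_cdf (r *: Q1) u.
    have [->|rn0] := eqVneq r 0.
      by rewrite mul0r scale0r /kernel_cdf size_poly0 big_ord0.
    rewrite /kernel_cdf size_scale // mulr_sumr; apply: eq_bigr => i _.
    by rewrite coefZ !mulrA.
  rewrite mulrBr !cdfZ; apply: kernel_cdf_le => // u /andP[ju uj].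
  rewrite /kernel hornerZ -mulrA; apply: QQ1.
  rewrite (le_trans (lt0 j) ju) /= (le_trans uj) // ler_wpM2l //.
  exact: nondecreasing_t.
apply: (@le_trans _ _ (b k * (kernel_cdf Q (lam * t N) - kernel_cdf Q (lam * t k)))).
  rewrite -(telescope_sumr (fun j => kernel_cdf Q (lam * t j)) kN) mulr_sumr.
  apply: ler_sum_nat => j /andP[kj _]; apply: ler_wpM2r; last exact: nonincreasing_b.
  by rewrite subr_ge0; apply: kernel_cdf_nondecreasing.
apply: ler_wpM2l; first exact: (sqlap_b_ge0 H).
rewrite lerBlDr; apply: le_trans (kernel_cdf_le_total Q0 (lt0 N)) _.
by rewrite lerDl -(kernel_cdf0 Q); apply: kernel_cdf_nondecreasing.
Qed.

(** Both this bound and [tauberian_lower] take [lam = u / t k], so that the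
    [k]-th point of the subdivision sits at [u]. *)
Lemma tauberian_upper (Q : {poly R}) (u eps : R) : sqrt_laplace ->
  (forall u, 0 <= u -> 0 <= kernel Q u) -> 0 < u -> 0 < kernel_cdf Q u -> 0 < eps ->
  \forall k \near \oo,
    b k * Num.sqrt (t k) <= Num.sqrt u * c * kernel_half Q / kernel_cdf Q u + eps.
Proof.
move=> H Q0 u0 K0 eps0; have su0 : 0 < Num.sqrt u by rewrite sqrtr_gt0.
pose e := eps * kernel_cdf Q u / Num.sqrt u.
have e0 : 0 < e by rewrite divr_gt0 // mulr_gt0.
have [d d0 dP] := kernel_sum_asym Q H e0.
near=> k; have tk : u / d < t k by near: k; apply: cvgry_gt; exact: (sqlap_t_cvgy H).
have tk0 : 0 < t k by apply: lt_trans tk; rewrite divr_gt0.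
have st0 : 0 < Num.sqrt (t k) by rewrite sqrtr_gt0.
have lam0 : 0 < u / t k by rewrite divr_gt0.
have [|N0 N0P] := dP (u / t k).
  by rewrite lam0 /= ltr_pdivrMr // mulrC -ltr_pdivrMr.
have := N0P (maxn N0 k) (leq_maxl _ _); rewrite ler_norml => /andP[_].
have := kernel_sum_ge H Q0 (ltW lam0) (leq_maxr N0 k).
rewrite divfK ?gt_eqF // => le1; rewrite lerBlDr => /(le_trans le1).
rewrite sqrtrM ?(ltW u0) // sqrtrV ?(ltW tk0) //.
rewrite -(ler_pM2r st0) => le2.
rewrite -(ler_pM2r K0) mulrDl divfK ?gt_eqF //.
have -> : b k * Num.sqrt (t k) * kernel_cdf Q u = b k * kernel_cdf Q u * Num.sqrt (t k).
  by ring.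
apply: le_trans le2 _; rewrite le_eqVlt; apply/orP; left; apply/eqP.
rewrite /e; move: (Num.sqrt u) (Num.sqrt (t k)) su0 st0 => x z x0 z0.
by field; rewrite !gt_eqF.
Unshelve. all: by end_near. Qed.

Lemma tauberian_lower (Q Q1 : {poly R}) (r u eps : R) : sqrt_laplace ->
  (forall u, 0 <= u -> 0 <= kernel Q u) -> (forall u, 0 <= u -> 0 <= kernel Q1 u) ->
  0 < u -> 0 < kernel_total Q -> 0 <= r ->
  (forall v, 0 <= v <= u -> kernel Q v <= r * kernel Q1 v) -> 0 < eps ->
  \forall k \near \oo,
    Num.sqrt u * c * (kernel_half Q - r * kernel_half Q1) / kernel_total Q - eps
      <= b k * Num.sqrt (t k).
Proof.
move=> H Q0 Q10 u0 K0 r0 QQ1 eps0; have su0 : 0 < Num.sqrt u by rewrite sqrtr_gt0.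
pose e := eps * kernel_total Q / Num.sqrt u / (1 + r).
have r1 : 0 < 1 + r by rewrite ltr_wpDr.
have e0 : 0 < e by rewrite divr_gt0 // divr_gt0 // mulr_gt0.
have [d d0 dP] := kernel_sum_asym Q H e0.
have [d1 d10 d1P] := kernel_sum_asym Q1 H e0.
near=> k; have tk : u / d < t k by near: k; apply: cvgry_gt; exact: (sqlap_t_cvgy H).
have tk1 : u / d1 < t k by near: k; apply: cvgry_gt; exact: (sqlap_t_cvgy H).
have tk0 : 0 < t k by apply: lt_trans tk; rewrite divr_gt0.
have st0 : 0 < Num.sqrt (t k) by rewrite sqrtr_gt0.
have lam0 : 0 < u / t k by rewrite divr_gt0.
have lamt : u / t k * t k = u by rewrite divfK ?gt_eqF.
have [|N0 N0P] := dP (u / t k).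
  by rewrite lam0 /= ltr_pdivrMr // mulrC -ltr_pdivrMr.
have [|N1 N1P] := d1P (u / t k).
  by rewrite lam0 /= ltr_pdivrMr // mulrC -ltr_pdivrMr.
pose N := maxn k (maxn N0 N1).
have := N0P N (leq_trans (leq_maxl _ _) (leq_maxr _ _)).
rewrite ler_norml => /andP[+ _]; rewrite lerBrDl => geQ.
have := N1P N (leq_trans (leq_maxr _ _) (leq_maxr _ _)).
rewrite ler_norml => /andP[_]; rewrite lerBlDr => leQ1.
have := @kernel_sum_le Q Q1 r (u / t k) k N H Q0 Q10 r0 (ltW lam0) (leq_maxl _ _).
rewrite lamt => /(_ QQ1) => le1.
have {leQ1} := ler_wpM2l r0 leQ1 => leQ1.
have : c * Num.sqrt (u / t k) * (kernel_half Q - r * kernel_half Q1)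
    - (1 + r) * e * Num.sqrt (u / t k) <= b k * kernel_total Q by lra.
rewrite sqrtrM ?(ltW u0) // sqrtrV ?(ltW tk0) //.
rewrite -(ler_pM2r st0) => le2.
rewrite -(ler_pM2r K0) mulrBl divfK ?gt_eqF //.
have -> : b k * Num.sqrt (t k) * kernel_total Q = b k * kernel_total Q * Num.sqrt (t k).
  by ring.
apply: le_trans _ le2; rewrite le_eqVlt; apply/orP; left; apply/eqP.
rewrite /e; move: (Num.sqrt u) (Num.sqrt (t k)) su0 st0 => x z x0 z0.
by field; rewrite !gt_eqF.
Unshelve. all: by end_near. Qed.

End Tauberian.

(** * Bump kernels *)
Section BumpKernels.
Context (R : realType).
Implicit Types (Q : {poly R}) (h u v : R) (n : nat).

Lemma coef_sum_lincomb (wt : nat -> R) (x : R) (Q1 Q2 : {poly R}) :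
  \sum_(i < size (x *: Q1 + Q2)) (x *: Q1 + Q2)`_i * wt i =
  x * (\sum_(i < size Q1) Q1`_i * wt i) + \sum_(i < size Q2) Q2`_i * wt i.
Proof.
have wide (Q : {poly R}) n : (size Q <= n)%N ->
    \sum_(i < size Q) Q`_i * wt i = \sum_(i < n) Q`_i * wt i.
  move=> Qn; rewrite (big_ord_widen n (fun i => Q`_i * wt i) Qn) [RHS](bigID (fun i : 'I_n => (i < size Q)%N)) /=.
  rewrite [X in _ = _ + X]big1 ?addr0 // => i; rewrite -leqNgt => le_i.
  by rewrite nth_default // mul0r.
pose n := maxn (size (x *: Q1 + Q2)) (maxn (size Q1) (size Q2)).
rewrite !(wide _ n) ?leq_max ?leqnn ?orbT // mulr_sumr -big_split /=.
by apply: eq_bigr => i _; rewrite coefD coefZ; ring.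
Qed.

Lemma kernel_half_lincomb x (Q1 Q2 : {poly R}) :
  kernel_half (x *: Q1 + Q2) = x * kernel_half Q1 + kernel_half Q2.
Proof. exact: (coef_sum_lincomb (fun i => (Num.sqrt i.+1%:R)^-1)). Qed.

Lemma kernel_total_lincomb x (Q1 Q2 : {poly R}) :
  kernel_total (x *: Q1 + Q2) = x * kernel_total Q1 + kernel_total Q2.
Proof. exact: (coef_sum_lincomb (fun i => i.+1%:R^-1)). Qed.

Lemma kernel_cdf_lincomb x (Q1 Q2 : {poly R}) u :
  kernel_cdf (x *: Q1 + Q2) u = x * kernel_cdf Q1 u + kernel_cdf Q2 u.
Proof.
have E Q : kernel_cdf Q u =
    \sum_(i < size Q) Q`_i * (i.+1%:R^-1 * (1 - expR (- (i.+1%:R * u)))).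
  by apply: eq_bigr => i _; rewrite mulrA.
by rewrite !E; exact: (coef_sum_lincomb (fun i => i.+1%:R^-1 * (1 - expR (- (i.+1%:R * u))))).
Qed.

Lemma kernel_lincomb x (Q1 Q2 : {poly R}) u :
  kernel (x *: Q1 + Q2) u = x * kernel Q1 u + kernel Q2 u.
Proof. by rewrite /kernel hornerD hornerZ mulrDl mulrA. Qed.

Lemma kernel_halfZ x Q : kernel_half (x *: Q) = x * kernel_half Q.
Proof.
by rewrite -[x *: Q]addr0 kernel_half_lincomb /kernel_half size_poly0 big_ord0 addr0.
Qed.

Lemma kernel_totalZ x Q : kernel_total (x *: Q) = x * kernel_total Q.
Proof.
by rewrite -[x *: Q]addr0 kernel_total_lincomb /kernel_total size_poly0 big_ord0 addr0.
Qed.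

Lemma kernelZ x Q u : kernel (x *: Q) u = x * kernel Q u.
Proof. by rewrite /kernel hornerZ mulrA. Qed.

(** The logistic bump [4 * x * (1 - x)] at [x = expR (- u)]: its powers are kernels
    that concentrate at its maximum, and can thus replace the polynomial
    approximation of a step function. *)
Definition bump u : R := 4 * expR (- u) * (1 - expR (- u)).

Definition bump_poly n : {poly R} := (4 *: ('X * (1 - 'X))) ^+ n * (4 *: (1 - 'X)).

Lemma kernel_bump n u : kernel (bump_poly n) u = bump u ^+ n.+1.
Proof.
have e1 : (1 - 'X : {poly R}).[expR (- u)] = 1 - expR (- u).
  by rewrite hornerD hornerN hornerX -[1 in LHS]polyC1 hornerC.
rewrite /kernel /bump_poly hornerM horner_exp !hornerZ hornerM hornerX e1 exprS /bump.
rewrite (mulrA 4 (expR _)); move: (_ ^+ n) => z; ring.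
Qed.

Lemma bump_ge0 u : 0 <= u -> 0 <= bump u.
Proof.
move=> u0; rewrite /bump mulr_ge0 ?mulr_ge0 ?expR_ge0 // subr_ge0.
by rewrite -expR0 ler_expR oppr_le0.
Qed.

Lemma kernel_bump_ge0 n u : 0 <= u -> 0 <= kernel (bump_poly n) u.
Proof. by move=> u0; rewrite kernel_bump exprn_ge0 // bump_ge0. Qed.

(** The points where [expR (- u)] is [1 / 2 + h] and [1 / 2 - h], on both sides of
    the maximum [u = ln 2]: there the bump equals [1 - 4 * h ^ 2], and it is larger
    exactly in between. *)
Definition bump_left h : R := - ln (1 / 2 + h).
Definition bump_right h : R := - ln (1 / 2 - h).

Lemma bumpE u : bump u = 1 - 4 * (expR (- u) - 1 / 2) ^+ 2.
Proof. by rewrite /bump; field. Qed.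

Lemma expR_bump_left h : 0 < h < 1 / 2 -> expR (- bump_left h) = 1 / 2 + h.
Proof. by move=> hh; rewrite opprK lnK // posrE; lra. Qed.

Lemma expR_bump_right h : 0 < h < 1 / 2 -> expR (- bump_right h) = 1 / 2 - h.
Proof. by move=> hh; rewrite opprK lnK // posrE; lra. Qed.

Lemma bump_left_gt0 h : 0 < h < 1 / 2 -> 0 < bump_left h.
Proof.
by move=> hh; rewrite -[_ < _]ltrN2 oppr0 -ltr_expR expR0 (expR_bump_left hh); lra.
Qed.

Lemma bump_left_lt_right h : 0 < h < 1 / 2 -> bump_left h < bump_right h.
Proof.
by move=> hh; rewrite -ltrN2 -ltr_expR (expR_bump_left hh) (expR_bump_right hh); lra.
Qed.

Lemma bump_rho_gt0 h : 0 < h < 1 / 2 -> 0 < 1 - 4 * h ^+ 2.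
Proof.
by move=> hh; have : 0 < (1 / 2 - h) * (1 / 2 + h) by [apply: mulr_gt0; lra]; lra.
Qed.

Lemma bump_left_le h u : 0 < h < 1 / 2 -> u <= bump_left h -> bump u <= 1 - 4 * h ^+ 2.
Proof.
move=> hh ux; have ex : 1 / 2 + h <= expR (- u).
  by rewrite -(expR_bump_left hh) ler_expR lerN2.
rewrite bumpE.
have : h ^+ 2 <= (expR (- u) - 1 / 2) ^+ 2.
  by apply: lerXn2r; rewrite ?nnegrE; lra.
lra.
Qed.

Lemma bump_right_le h u : 0 < h < 1 / 2 -> bump_right h <= u -> bump u <= 1 - 4 * h ^+ 2.
Proof.
move=> hh ux; have ex : expR (- u) <= 1 / 2 - h.
  by rewrite -(expR_bump_right hh) ler_expR lerN2.
rewrite bumpE.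
have : h ^+ 2 <= (1 / 2 - expR (- u)) ^+ 2.
  by apply: lerXn2r; rewrite ?nnegrE; lra.
lra.
Qed.

Lemma bump_mid_ge h u : 0 < h < 1 / 2 -> bump_left h <= u <= bump_right h ->
  1 - 4 * h ^+ 2 <= bump u.
Proof.
move=> hh /andP[lu ur]; have u1 : expR (- u) <= 1 / 2 + h.
  by rewrite -(expR_bump_left hh) ler_expR lerN2.
have u2 : 1 / 2 - h <= expR (- u) by rewrite -(expR_bump_right hh) ler_expR lerN2.
rewrite bumpE.
have : `|expR (- u) - 1 / 2| ^+ 2 <= h ^+ 2.
  by apply: lerXn2r; rewrite ?nnegrE ?normr_ge0 // ?ler_norml; lra.
by rewrite real_normK ?num_real //; lra.
Qed.

Lemma bump_pow_le h n u : 0 < h < 1 / 2 -> 0 <= u -> bump u <= 1 - 4 * h ^+ 2 ->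
  kernel (bump_poly n) u <= (1 - 4 * h ^+ 2) ^+ n * kernel (bump_poly 0) u.
Proof.
move=> hh u0 le; have b0 := bump_ge0 u0; rewrite !kernel_bump expr1 exprSr ler_wpM2r //.
by apply: lerXn2r => //; rewrite nnegrE // (le_trans b0).
Qed.

(** The total mass decays slower than the bound [(1 - 4 * h' ^ 2) ^ n] on the bump
    outside a window with [h' > h]. *)
Lemma bump_total_ge h : 0 < h < 1 / 2 -> exists2 k : R, 0 < k &
  forall n, (1 - 4 * h ^+ 2) ^+ n * k <= kernel_total (bump_poly n).
Proof.
move=> hh; have l0 := bump_left_gt0 hh; have lr := bump_left_lt_right hh.
set l := bump_left h in l0 lr *; set r := bump_right h in lr *.
have rho0 := bump_rho_gt0 hh.
exists (kernel_cdf (bump_poly 0) r - kernel_cdf (bump_poly 0) l).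
  have cont : {within `[l, r], continuous (kernel_cdf (bump_poly 0))}.
    by apply: derivable_within_continuous => x _; have [] := is_derive_kernel_cdf (bump_poly 0) x.
  have [c cin ->] := @MVT R _ _ l r lr (fun x _ => is_derive_kernel_cdf (bump_poly 0) x) cont.
  rewrite mulr_gt0 ?subr_gt0 // kernel_bump expr1; apply: lt_le_trans rho0 _.
  by apply: bump_mid_ge => //; move: cin; rewrite in_itv /= => /andP[/ltW -> /ltW ->].
move=> n; have : kernel_cdf ((1 - 4 * h ^+ 2) ^+ n *: bump_poly 0 + 0) r -
    kernel_cdf ((1 - 4 * h ^+ 2) ^+ n *: bump_poly 0 + 0) l <=
    kernel_cdf (bump_poly n) r - kernel_cdf (bump_poly n) l.
  apply: kernel_cdf_le; first exact: ltW.
  move=> u /andP[lu ur]; rewrite addr0 /kernel hornerZ -mulrA -/(kernel _ u) -/(kernel _ u).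
  have u0 : 0 <= u by apply: le_trans lu; exact: ltW.
  rewrite !kernel_bump expr1 [bump u ^+ _]exprSr; apply: ler_wpM2r; first exact: bump_ge0.
  have rho_le : 1 - 4 * h ^+ 2 <= bump u by apply: bump_mid_ge; rewrite ?lu.
  by apply: lerXn2r => //; rewrite nnegrE ?bump_ge0 // ltW.
have cdf00 u : kernel_cdf (0 : {poly R}) u = 0 by rewrite /kernel_cdf size_poly0 big_ord0.
rewrite !kernel_cdf_lincomb !cdf00 !addr0 -mulrBr => /le_trans; apply.
have r0 : 0 <= r by apply: ltW; apply: lt_trans lr.
apply: le_trans (kernel_cdf_le_total (kernel_bump_ge0 n) r0).
rewrite gerBl -(kernel_cdf0 (bump_poly n)).
by apply: kernel_cdf_nondecreasing; [exact: kernel_bump_ge0|by []|exact: ltW].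
Qed.

(** The bump lives where [u >= bump_left h], so that its weight [u ^ (- 1 / 2)] is at
    most [(bump_left h) ^ (- 1 / 2)] up to the part that leaks to the left. *)
Lemma bump_half_le h n : 0 < h < 1 / 2 ->
  Num.sqrt pi * kernel_half (bump_poly n) <=
    kernel_total (bump_poly n) / Num.sqrt (bump_left h)
    + (1 - 4 * h ^+ 2) ^+ n * (Num.sqrt pi * kernel_half (bump_poly 0)).
Proof.
move=> hh; set rho := (_ - _) ^+ n; have l0 := bump_left_gt0 hh.
have rho0 : 0 <= rho by rewrite exprn_ge0 // ltW // bump_rho_gt0.
set l := Num.sqrt (bump_left h); have sl0 : 0 < l by rewrite sqrtr_gt0.
have := @kernel_positivity R (-1 *: bump_poly n + rho *: bump_poly 0) (l^-1 *: bump_poly n).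
rewrite kernel_half_lincomb kernel_halfZ kernel_totalZ => H.
have {H} : 0 <= Num.sqrt pi * (-1 * kernel_half (bump_poly n) + rho * kernel_half (bump_poly 0))
    + l^-1 * kernel_total (bump_poly n); last lra.
apply: H => v v0; rewrite kernel_lincomb !kernelZ.
have kn := kernel_bump_ge0 n (sqr_ge0 v); have k0 := kernel_bump_ge0 0 (sqr_ge0 v).
have rk0 := mulr_ge0 rho0 k0.
have [vl|lv] := leP (v ^+ 2) (bump_left h).
  have := bump_pow_le n hh (sqr_ge0 v) (bump_left_le hh vl); rewrite -/rho => le.
  have : 0 <= v * (l^-1 * kernel (bump_poly n) (v ^+ 2)).
    by apply: mulr_ge0 v0 (mulr_ge0 _ kn); rewrite invr_ge0 ltW.
  by lra.
have lev : l <= v by rewrite -[leRHS]ger0_norm // -sqrtr_sqr ler_wsqrtr // ltW.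
have : 1 * kernel (bump_poly n) (v ^+ 2) <= v / l * kernel (bump_poly n) (v ^+ 2).
  by apply: ler_wpM2r => //; rewrite ler_pdivlMr // mul1r.
by rewrite -mulrA; lra.
Qed.

(** The converse comparison: the bump lives where [u <= bump_right h]. *)
Lemma bump_total_le h n : 0 < h < 1 / 2 ->
  kernel_total (bump_poly n) <=
    Num.sqrt (bump_right h) * (Num.sqrt pi * kernel_half (bump_poly n))
    + (1 - 4 * h ^+ 2) ^+ n * kernel_total (bump_poly 0).
Proof.
move=> hh; set rho := (_ - _) ^+ n; have l0 := bump_left_gt0 hh.
have rho0 : 0 <= rho by rewrite exprn_ge0 // ltW // bump_rho_gt0.
have r0 : 0 < bump_right h by apply: lt_trans (bump_left_lt_right hh).
set r := Num.sqrt (bump_right h); have sr0 : 0 < r by rewrite sqrtr_gt0.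
have := @kernel_positivity R (r *: bump_poly n) (-1 *: bump_poly n + rho *: bump_poly 0).
rewrite kernel_total_lincomb kernel_halfZ kernel_totalZ => H.
have {H} : 0 <= Num.sqrt pi * (r * kernel_half (bump_poly n)) +
   (-1 * kernel_total (bump_poly n) + rho * kernel_total (bump_poly 0)); last lra.
apply: H => v v0; rewrite kernel_lincomb !kernelZ.
have kn := kernel_bump_ge0 n (sqr_ge0 v); have k0 := kernel_bump_ge0 0 (sqr_ge0 v).
have rk0 := mulr_ge0 rho0 k0.
have [rv|vr] := leP (bump_right h) (v ^+ 2).
  have := bump_pow_le n hh (sqr_ge0 v) (bump_right_le hh rv); rewrite -/rho.
  move=> /(ler_wpM2l v0); have : 0 <= r * kernel (bump_poly n) (v ^+ 2).
    by rewrite mulr_ge0 // ltW.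
  by lra.
have lev : v <= r by rewrite -[leLHS]ger0_norm // -sqrtr_sqr ler_wsqrtr // ltW.
have := ler_wpM2r kn lev; have := mulr_ge0 v0 rk0; lra.
Qed.

Lemma bump_cdf_ge h n : 0 < h < 1 / 2 ->
  kernel_total (bump_poly n) - (1 - 4 * h ^+ 2) ^+ n * kernel_total (bump_poly 0) <=
    kernel_cdf (bump_poly n) (bump_right h).
Proof.
move=> hh; set rho := (_ - _) ^+ n; have l0 := bump_left_gt0 hh.
have rho0 : 0 <= rho by rewrite exprn_ge0 // ltW // bump_rho_gt0.
have r0 : 0 < bump_right h by apply: lt_trans (bump_left_lt_right hh).
set r := bump_right h in r0 *.
rewrite lerBlDr -(cvg_lim (@Rhausdorff R) (@cvg_kernel_cdf R (bump_poly n))).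
apply: limr_le; first by apply/cvg_ex; eexists; exact: cvg_kernel_cdf.
near=> v; have rv : r <= v by near: v; apply: nbhs_pinfty_ge; exact: num_real.
have := @kernel_cdf_le R (bump_poly n) (rho *: bump_poly 0 + 0) r v rv.
have cdf00 u : kernel_cdf (0 : {poly R}) u = 0 by rewrite /kernel_cdf size_poly0 big_ord0.
rewrite !kernel_cdf_lincomb !cdf00 !addr0 => H.
have {}H : kernel_cdf (bump_poly n) v - kernel_cdf (bump_poly n) r <=
    rho * kernel_cdf (bump_poly 0) v - rho * kernel_cdf (bump_poly 0) r.
  apply: H => u /andP[ru _]; rewrite kernelZ.
  apply: bump_pow_le => //; last exact: bump_right_le.
  by apply: le_trans ru; exact: ltW.
have v0 : 0 <= v by apply: le_trans rv; exact: ltW.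
have t0 := ler_wpM2l rho0 (kernel_cdf_le_total (@kernel_bump_ge0 0) v0).
have c0 : 0 <= kernel_cdf (bump_poly 0) r.
  rewrite -(kernel_cdf0 (bump_poly 0)); apply: kernel_cdf_nondecreasing => //.
    exact: kernel_bump_ge0.
  exact: ltW.
have := mulr_ge0 rho0 c0; lra.
Unshelve. all: by end_near. Qed.

End BumpKernels.

(** * A Tauberian theorem for the exponent one half *)
Lemma bump_ratio_cvg (R : realType) :
  Num.sqrt (bump_right h) / Num.sqrt (bump_left h) @[h --> (0 : R)^'+] --> (1 : R).
Proof.
have half0 : 0 < 1 / 2 :> R by lra.
have L0 : 0 < - ln (1 / 2) :> R.
  by rewrite oppr_gt0 ln_lt0 //; lra.
have cvgl (s : R) : - ln (1 / 2 + s * h) @[h --> (0 : R)^'+] --> - ln (1 / 2).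
  have lin : 1 / 2 + s * h @[h --> (0 : R)^'+] --> (1 / 2 : R).
    have id0 : h @[h --> (0 : R)^'+] --> (0 : R) by apply: cvg_at_right_filter; exact: cvg_id.
    rewrite [X in _ --> X](_ : _ = 1 / 2 + s * 0); last by rewrite mulr0 addr0.
    by apply: cvgD; [exact: cvg_cst|apply: cvgM => //; exact: cvg_cst].
  by apply: cvgN; exact: (cvg_comp _ _ lin (continuous_ln half0)).
have sq (f : R -> R) : f h @[h --> (0 : R)^'+] --> - ln (1 / 2) ->
    Num.sqrt (f h) @[h --> (0 : R)^'+] --> Num.sqrt (- ln (1 / 2)).
  by move=> fc; apply: continuous_cvg fc; exact: sqrt_continuous.
rewrite [X in _ --> X](_ : _ = Num.sqrt (- ln (1 / 2)) / Num.sqrt (- ln (1 / 2))); last first.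
  by rewrite divff // gt_eqF // sqrtr_gt0.
apply: cvgM.
  apply: sq; have := cvgl (-1); apply: cvg_trans; apply: near_eq_cvg.
  by apply: nearW => h; rewrite /bump_right mulN1r.
apply: cvgV; first by rewrite gt_eqF // sqrtr_gt0.
apply: sq; have := cvgl 1; apply: cvg_trans; apply: near_eq_cvg.
by apply: nearW => h; rewrite /bump_left (mul1r h).
Qed.

Lemma bump_leak_cvg0 (R : realType) (h : R) : 0 < h < 1 / 2 ->
  (1 - 4 * h ^+ 2) ^+ n / kernel_total (bump_poly R n) @[n --> \oo] --> (0 : R).
Proof.
move=> hh; have hh2 : 0 < h / 2 < 1 / 2 by lra.
have [k k0 kP] := bump_total_ge hh2.
have rho0 := bump_rho_gt0 hh; have rho20 := bump_rho_gt0 hh2.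
set rho := 1 - 4 * h ^+ 2 in rho0 *; set rho2 := 1 - 4 * (h / 2) ^+ 2 in rho20 kP.
have lt_rho : rho < rho2.
  have : 0 < h ^+ 2 by rewrite exprn_gt0 //; lra.
  by rewrite /rho /rho2; lra.
apply: (@squeeze_cvgr _ _ _ _ (cst 0) (fun n => (rho / rho2) ^+ n * k^-1)).
- apply: nearW => n; have pn := lt_le_trans (mulr_gt0 (exprn_gt0 n rho20) k0) (kP n).
  apply/andP; split; first by rewrite divr_ge0 ?exprn_ge0 // ltW.
  rewrite expr_div_n -mulrA -invfM; apply: ler_wpM2l; first by rewrite exprn_ge0 // ltW.
  by rewrite lef_pV2 ?posrE // mulr_gt0 // exprn_gt0.
- exact: cvg_cst.
- rewrite -(mul0r k^-1); apply: cvgM; last exact: cvg_cst.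
  apply: cvg_expr; rewrite ger0_norm; first by rewrite ltr_pdivrMr // mul1r.
  by rewrite divr_ge0 // ltW.
Qed.

(** If [b] behaves like [C / Num.sqrt (t k)], then [C * Num.sqrt pi] is the constant
    in front of [Num.sqrt lam]; monotonicity of [b] yields the converse. A power
    of the bump is nearly a point mass, which puts both the upper and the lower
    bound on [b k * Num.sqrt (t k)] within a factor close to
    [Num.sqrt (bump_right h / bump_left h)] of [C]. First [h] is chosen, then the power
    [n], so that what leaks out of the window is negligible, and then [k]. *)
Theorem sqrt_tauberian (R : realType) (b t : nat -> R) (c : R) :
  sqrt_laplace b t c ->
  b k * Num.sqrt (t k) @[k --> \oo] --> c / Num.sqrt pi.
Proof.
move=> H; apply/cvgrPdist_le => eps eps0.
have e30 : 0 < eps / 3 by rewrite divr_gt0.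
have spi0 : 0 < Num.sqrt pi :> R by rewrite sqrtr_gt0 pi_gt0.
pose C := c / Num.sqrt pi.
have sgm1 : C * (Num.sqrt (bump_right h) / Num.sqrt (bump_left h)) @[h --> (0 : R)^'+] --> C * 1.
  by apply: cvgM; [exact: cvg_cst|exact: bump_ratio_cvg].
have sgm2 : C * (Num.sqrt (bump_right h) / Num.sqrt (bump_left h))^-1
    @[h --> (0 : R)^'+] --> C * 1^-1.
  apply: cvgM; first exact: cvg_cst.
  by apply: cvgV; [rewrite oner_eq0|exact: bump_ratio_cvg].
have [h [h1 [h2 [h3 h4]]]] : exists h : R,
    C * (Num.sqrt (bump_right h) / Num.sqrt (bump_left h)) < C + eps / 3 /\
    (C - eps / 3 < C * (Num.sqrt (bump_right h) / Num.sqrt (bump_left h))^-1 /\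
    (0 < h /\ h < 1 / 2)).
  apply: (@filter_ex _ (0 : R)^'+); apply: filterI.
    by apply: (cvgr_lt _ sgm1); rewrite mulr1 ltrDl.
  apply: filterI; first by apply: (cvgr_gt _ sgm2); rewrite invr1 mulr1 gtrDl oppr_lt0.
  by apply: filterI; [exact: nbhs_right_gt|apply: nbhs_right_lt; lra].
have hh : 0 < h < 1 / 2 by rewrite h3 h4.
have l0 := bump_left_gt0 hh; have r0 : 0 < bump_right h.
  by apply: lt_trans (bump_left_lt_right hh).
have sl0 : 0 < Num.sqrt (bump_left h) by rewrite sqrtr_gt0.
have sr0 : 0 < Num.sqrt (bump_right h) by rewrite sqrtr_gt0.
have rho0 := bump_rho_gt0 hh.
pose T n := kernel_total (bump_poly R n); pose W n := kernel_half (bump_poly R n).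
pose leak n := (1 - 4 * h ^+ 2) ^+ n / T n.
have T_gt0 n : 0 < T n.
  have hh2 : 0 < h / 2 < 1 / 2 by lra.
  have [k k0 kP] := bump_total_ge hh2.
  by apply: lt_le_trans (kP n); rewrite mulr_gt0 // exprn_gt0 // bump_rho_gt0.
have rhoE n : (1 - 4 * h ^+ 2) ^+ n = leak n * T n by rewrite /leak divfK // gt_eqF.
set sl := Num.sqrt (bump_left h) in h1 h2 sl0; set sr := Num.sqrt (bump_right h) in h1 h2 sr0.
set spi := Num.sqrt pi in spi0 C sgm1 sgm2 h1 h2 *.
have leak0 : leak n @[n --> \oo] --> (0 : R) by exact: bump_leak_cvg0.
pose up n := sr * C * ((sl^-1 + leak n * (spi * W 0%N)) / (1 - leak n * T 0%N)).
pose lo n := sl * C * ((1 - leak n * T 0%N) / sr - leak n * (spi * W 0%N)).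
have leak_one : 1 - leak n * T 0%N @[n --> \oo] --> (1 : R).
  rewrite [X in _ --> X](_ : _ = 1 - 0 * T 0%N); last by rewrite mul0r subr0.
  by apply: cvgB; [exact: cvg_cst|apply: cvgM => //; exact: cvg_cst].
have leak_half : leak n * (spi * W 0%N) @[n --> \oo] --> (0 : R).
  rewrite [X in _ --> X](_ : _ = 0 * (spi * W 0%N)); last by rewrite mul0r.
  by apply: cvgM => //; exact: cvg_cst.
have up_cvg : up n @[n --> \oo] --> C * (sr / sl).
  rewrite [X in _ --> X](_ : _ = sr * C * ((sl^-1 + 0) / 1)); last first.
    by rewrite addr0 divr1; ring.
  apply: cvgM; first exact: cvg_cst.
  apply: cvgM; first by apply: cvgD => //; exact: cvg_cst.
  by apply: cvgV => //; exact: oner_neq0.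
have lo_cvg : lo n @[n --> \oo] --> C * (sr / sl)^-1.
  rewrite [X in _ --> X](_ : _ = sl * C * (1 / sr - 0)); last first.
    by rewrite subr0 invf_div; field; rewrite gt_eqF.
  apply: cvgM; first exact: cvg_cst.
  by apply: cvgB => //; apply: cvgM => //; exact: cvg_cst.
have [n [n1 [n2 n3]]] : exists n : nat,
    1 / 2 < 1 - leak n * T 0%N /\ (up n < C + eps / 3 + eps / 3 /\ C - eps / 3 - eps / 3 < lo n).
  apply: (@filter_ex _ \oo); apply: filterI; first by apply: (cvgr_gt _ leak_one); lra.
  apply: filterI; first by apply: (cvgr_lt _ up_cvg); lra.
  by apply: (cvgr_gt _ lo_cvg); lra.
have c0 := sqlap_c_ge0 H.
have C0 : 0 <= C by rewrite divr_ge0 // ltW.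
have halfT := bump_half_le n hh; have totT := bump_total_le n hh; have cdfT := bump_cdf_ge n hh.
rewrite rhoE -/(T n) -/(T 0%N) -/(W n) -/(W 0%N) -/sl -/sr -/spi in halfT totT cdfT.
have cC : c = C * spi by rewrite /C divfK // gt_eqF.
have cdf_gt0 : 0 < kernel_cdf (bump_poly R n) (bump_right h).
  apply: lt_le_trans cdfT; have : 0 < T n * (1 - leak n * T 0%N) by apply: mulr_gt0 => //; lra.
  lra.
have le_up : sr * c * W n / kernel_cdf (bump_poly R n) (bump_right h) <= up n.
  have -> : sr * c * W n / kernel_cdf (bump_poly R n) (bump_right h) =
    sr * C * (spi * W n / kernel_cdf (bump_poly R n) (bump_right h)) by rewrite cC; ring.
  apply: ler_wpM2l; first by apply: mulr_ge0 => //; exact: ltW.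
  have den0 : 0 < 1 - leak n * T 0%N by lra.
  rewrite ler_pdivrMr // mulrAC ler_pdivlMr //.
  have num0 : 0 <= sl^-1 + leak n * (spi * W 0%N).
    have W0 : 0 <= spi * W 0%N.
      have := @kernel_positivity R (bump_poly R 0) 0.
      rewrite [kernel_total 0]/kernel_total size_poly0 big_ord0 addr0; apply => v v0.
      by rewrite [kernel 0 _]/kernel horner0 mul0r mulr0 addr0 kernel_bump_ge0 // sqr_ge0.
    have leak_ge0 : 0 <= leak n by apply: divr_ge0; [rewrite exprn_ge0 // ltW|exact: ltW].
    by apply: addr_ge0 (mulr_ge0 leak_ge0 W0); rewrite invr_ge0 ltW.
  apply: le_trans (ler_wpM2l num0 cdfT).
  have := ler_wpM2r (ltW den0) halfT; lra.
have le_lo : lo n <= sl * c * (W n - leak n * T n * W 0%N) / T n.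
  have -> : sl * c * (W n - leak n * T n * W 0%N) / T n =
    sl * C * ((spi * W n - leak n * T n * (spi * W 0%N)) / T n) by rewrite cC; ring.
  apply: ler_wpM2l; first by apply: mulr_ge0 => //; exact: ltW.
  rewrite ler_pdivlMr // mulrBl.
  have : (1 - leak n * T 0%N) / sr * T n <= spi * W n.
    by rewrite mulrAC ler_pdivrMr //; lra.
  lra.
have up_near := tauberian_upper H (@kernel_bump_ge0 R n) r0 cdf_gt0 e30.
have lo_near := @tauberian_lower R b t c (bump_poly R n) (bump_poly R 0) (leak n * T n)
  (bump_left h) (eps / 3) H (@kernel_bump_ge0 R n) (@kernel_bump_ge0 R 0) l0 (T_gt0 n).
rewrite -rhoE in lo_near.
have {lo_near} := lo_near (exprn_ge0 n (ltW rho0)) _ e30.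
have dom v : 0 <= v <= bump_left h ->
    kernel (bump_poly R n) v <= (1 - 4 * h ^+ 2) ^+ n * kernel (bump_poly R 0) v.
  by move=> /andP[v0 vl]; apply: bump_pow_le => //; exact: bump_left_le.
move=> /(_ dom) lo_near.
near=> k; rewrite ler_norml -/C.
have upk : b k * Num.sqrt (t k) <= sr * c * W n / kernel_cdf (bump_poly R n) (bump_right h) + eps / 3.
  by near: k; exact: up_near.
have lok : sl * c * (W n - (1 - 4 * h ^+ 2) ^+ n * W 0%N) / T n - eps / 3 <= b k * Num.sqrt (t k).
  by near: k; exact: lo_near.
rewrite rhoE in lok.
apply/andP; split; lra.
Unshelve. all: by end_near. Qed.

(** * Survival probabilities *)
Section SurvivalAsymptotics.
Context (R : realType) (alpha : R) (m y : nat) (w : nat -> nat -> R) (a : nat -> R).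
Context (kw : killed_walk alpha m y w) (nrm : normalizing alpha a).

Let b k := survival w (m + k).
Let t k := clock m a (m + k).
Let M := a m * y%:R.

Lemma clock_cvgy : t k @[k --> \oo] --> +oo.
Proof.
apply/cvgryPge => A; have /cvgryPge/(_ (A + sum_sqr a m)) := sum_sqr_cvgy nrm.
case=> N _ H; exists N => // n Nn; rewrite /t /clock lerBrDr.
by apply: H; apply: leq_trans Nn _; exact: leq_addl.
Qed.

Lemma laplace_incrementsE (s : R) N :
  laplace_increments b t (s ^+ 2 / 2) N = laplace_sum m w a s (m + N).
Proof.
rewrite /laplace_increments /laplace_sum.
elim: N => [|N IH]; first by rewrite addn0 !big_geq.
by rewrite addnS !big_nat_recr ?leq_addr //= IH /t addnS.
Qed.

Lemma one_sub_expN_ge (x : R) : 0 <= x -> x - x ^+ 2 <= 1 - expR (- x).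
Proof.
move=> x0; have x1 : 0 < 1 + x by lra.
have : expR (- x) <= (1 + x)^-1.
  by rewrite expRN lef_pV2 ?posrE ?expR_gt0 // expR_ge1Dx.
move=> H; have : (1 + x) * (1 + x)^-1 = 1 by rewrite divff ?gt_eqF.
have : 0 < (1 + x)^-1 by rewrite invr_gt0.
move: H; set z := (1 + x)^-1; nra.
Qed.

Lemma exp_clock_small (s e : R) : 0 < s -> 0 < e ->
  exists N0 : nat, forall N, (N0 <= N)%N -> exp_clock m a s (m + N) <= e.
Proof.
move=> s0 e0; have /cvgryPge/(_ (2 / s ^+ 2 * e^-1)) := clock_cvgy.
case=> N0 _ H; exists N0 => N /H; rewrite /= -/(t _) /exp_clock -/(t N).
have s2 : 0 < s ^+ 2 / 2 by rewrite divr_gt0 // exprn_gt0.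
move=> Ht; rewrite expRN invf_ple ?posrE ?expR_gt0 //.
apply: le_trans (expR_ge1Dx _); apply: (@le_trans _ _ (s ^+ 2 / 2 * t N)); last lra.
apply: le_trans (ler_wpM2l (ltW s2) Ht).
by rewrite mulrA mulrA divfK ?divff ?mul1r // gt_eqF // exprn_gt0.
Qed.

(** With [lam = s ^ 2 / 2] the asymptotics [M * s] of the Laplace sum reads
    [Num.sqrt 2 * M * Num.sqrt lam]. *)
Lemma survival_sqrt_laplace : sqrt_laplace b t (Num.sqrt 2 * M).
Proof.
have [alpha_gtN1 alpha_le_half a_gt0 aS] := nrm.
have m0 := killed_m_gt0 kw.
have M0 : 0 <= M by rewrite mulr_ge0 // ltW // a_gt0.
split.
- by move=> k; exact: (survival_ge0 kw).
- by move=> k; rewrite /b addnS; apply: (survivalS kw nrm); exact: leq_addr.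
- by rewrite /t /clock addn0 subrr.
- by move=> k; rewrite /t /clock lerB // sum_sqr_nondecreasing // leq_add2l.
- exact: clock_cvgy.
- by rewrite mulr_ge0.
move=> eps eps0; have sqrt2 : 0 < Num.sqrt 2 :> R by rewrite sqrtr_gt0.
pose e := eps / Num.sqrt 2; have e0 : 0 < e by rewrite divr_gt0.
have /nbhs_ballP[d /= d0 Hd] := laplace_sum_le kw nrm e0.
pose d1 := Num.min d (e / 2 / (M ^+ 2 + 1)).
have M1 : 0 < M ^+ 2 + 1 by have := sqr_ge0 M; lra.
have d10 : 0 < d1 by rewrite lt_min d0 !divr_gt0.
exists (d1 ^+ 2 / 2); first by rewrite divr_gt0 // exprn_gt0.
move=> lam /andP[lam0 lamd].
pose s := Num.sqrt (2 * lam).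
have s0 : 0 < s by rewrite sqrtr_gt0 mulr_gt0.
have sE : s ^+ 2 / 2 = lam by rewrite sqr_sqrtr ?mulr_ge0 ?ltW // mulrAC divff ?mul1r.
have sd : s < d1.
  rewrite -(ltr_pXn2r (n := 2)) ?nnegrE ?ltW //; move: lamd; rewrite -sE; lra.
have sqE : Num.sqrt 2 * Num.sqrt lam = s by rewrite /s sqrtrM.
have [N0 HN] := exp_clock_small s0 (mulr_gt0 (divr_gt0 e0 (ltr0Sn R 1)) s0).
exists N0 => N /HN small; rewrite -sE laplace_incrementsE sE.
have -> : Num.sqrt 2 * M * Num.sqrt lam = M * s by rewrite -sqE mulrAC mulrC.
have -> : eps * Num.sqrt lam = e * s by rewrite -sqE /e mulrA divfK // gt_eqF.
move: sd; rewrite lt_min => /andP[sd sM].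
have upper : laplace_sum m w a s (m + N) <= (M + e) * s.
  by apply: Hd => //; [rewrite /ball /= sub0r normrN gtr0_norm|exact: leq_addr].
have lower : 1 - expR (- (s * M)) - exp_clock m a s (m + N) <= laplace_sum m w a s (m + N).
  by have := laplace_sum_ge kw nrm (ltW s0) (leq_addr N m); rewrite -(mulrA s).
have x0 : 0 <= s * M by rewrite mulr_ge0 // ltW.
have linear := one_sub_expN_ge x0.
have quad : (s * M) ^+ 2 <= e / 2 * s.
  rewrite exprMn expr2 -mulrA [e / 2 * s]mulrC; apply: ler_wpM2l; first exact: ltW.
  move: sM; rewrite ltr_pdivlMr // => sM.
  by apply: ltW; apply: le_lt_trans sM; rewrite ler_wpM2l ?ltW // ltrDl.
rewrite ler_norml; move: lower upper small quad linear {x0}.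
move: (expR (- (s * M))) (laplace_sum m w a s _) (exp_clock m a s _) => E L F.
by move: (M) (e) => *; lra.
Qed.

Theorem survival_cvg :
  survival w (m + k) * Num.sqrt (sum_sqr a (m + k) - sum_sqr a m) @[k --> \oo] -->
  Num.sqrt 2 * M / Num.sqrt pi.
Proof. exact: sqrt_tauberian survival_sqrt_laplace. Qed.

End SurvivalAsymptotics.

(** * The Gamma function and the constants of the elephant *)
Section GammaFunction.
Context (R : realType).
Let mu := @lebesgue_measure R.

Definition euler_integrand (r t : R) : R := t `^ (r - 1) * expR (- t).

(** The extended real version of [Gamma], to which monotone limits apply before
    finiteness is known. *)
Definition euler_integral (r : R) : \bar R :=
  (\int[mu]_(t in `]0%R, +oo[) (euler_integrand r t)%:E)%E.

Lemma euler_integrand_ge0 r t : 0 <= euler_integrand r t.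
Proof. by rewrite mulr_ge0 ?powR_ge0 ?expR_ge0. Qed.

Lemma measurable_euler_integrand r (A : set R) : measurable_fun A (euler_integrand r).
Proof.
apply: measurable_funM.
  by apply: measurable_funTS; exact: measurable_powR.
by apply: measurable_funTS; apply: measurableT_comp.
Qed.

Lemma is_derive_powR (r t : R) : 0 < t ->
  is_derive t (1 : R) (fun u : R => u `^ r) (r * t `^ (r - 1)).
Proof.
move=> t0; have tin : t \in `]0, +oo[ by rewrite in_itv /= t0.
apply: DeriveDef; first exact: derivable_powR.
by rewrite -derive1E powR_derive1.
Qed.

Lemma derivable_continuous_at (f : R -> R) (t : R) : derivable f t 1 -> {for t, continuous f}.
Proof. by move=> df; apply/differentiable_continuous/derivable1_diffP. Qed.

Lemma continuous_powR_at r (t : R) : 0 < t -> {for t, continuous (fun u : R => u `^ r)}.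
Proof. by move=> t0; apply: derivable_continuous_at; have [] := is_derive_powR r t0. Qed.

Lemma continuous_expRN (t : R) : {for t, continuous (fun u : R => expR (- u))}.
Proof. by apply: continuous_comp; [exact: opp_continuous|exact: continuous_expR]. Qed.

Lemma continuous_euler_integrand r (t : R) : 0 < t -> {for t, continuous (euler_integrand r)}.
Proof.
move=> t0; apply: cvgM; [exact: continuous_powR_at|exact: continuous_expRN].
Qed.

Lemma within_continuous_itv_gt0 (f : R -> R) (a b : R) : 0 < a ->
  (forall t, 0 < t -> {for t, continuous f}) -> {within `[a, b], continuous f}.
Proof.
move=> a0 cf; apply: continuous_in_subspaceT => t; rewrite inE /= in_itv /= => /andP[at_ _].
by apply: cf; exact: lt_le_trans at_.
Qed.

Lemma euler_integral_by_parts r (a b : R) : 0 < a -> a < b ->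
  (\int[mu]_(t in `[a, b]) (euler_integrand (r + 1) t)%:E =
   (a `^ r * expR (- a) - b `^ r * expR (- b))%:E +
   r%:E * \int[mu]_(t in `[a, b]) (euler_integrand r t)%:E)%E.
Proof.
move=> a0 ab.
have dexp (t : R) : is_derive t (1 : R) (fun u : R => - expR (- u)) (expR (- t)).
  by apply: is_derive_eq; rewrite mulrN1 opprK.
have LR (f : R -> R) : (forall t : R, 0 < t -> derivable f t 1) -> derivable_oo_LRcontinuous f a b.
  move=> df; have cf t : 0 < t -> {for t, continuous f}.
    by move=> t0; apply: derivable_continuous_at; exact: df.
  split.
  - by move=> t; rewrite in_itv /= => /andP[at_ _]; apply: df; exact: lt_trans at_.
  - by apply: cvg_at_right_filter; exact: cf.
  - by apply: cvg_at_left_filter; apply: cf; exact: lt_trans ab.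
have intg : mu.-integrable `[a, b] (EFin \o euler_integrand r).
  apply: continuous_compact_integrable; first exact: segment_compact.
  by apply: within_continuous_itv_gt0 => // t; exact: continuous_euler_integrand.
transitivity (\int[mu]_(t in `[a, b]) (t `^ r * expR (- t))%:E)%E.
  by apply: eq_integral => t _; rewrite /euler_integrand addrK.
rewrite (@integration_by_parts R (fun u : R => u `^ r) (fun u : R => - expR (- u))
  (fun u => r * u `^ (r - 1)) (fun u => expR (- u)) a b ab).
- congr (_ + _)%E; first by congr EFin; ring.
  transitivity (- (\int[mu]_(t in `[a, b]) ((- r)%:E * (euler_integrand r t)%:E)))%E.
    by congr (- _)%E; apply: eq_integral => t _; rewrite -EFinM /euler_integrand; congr EFin; ring.
  by rewrite integralZl // EFinN mulNe oppeK.
- apply: within_continuous_itv_gt0 => // t t0; apply: cvgM; first exact: cvg_cst.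
  exact: continuous_powR_at.
- by apply: LR => t t0; have [] := is_derive_powR r t0.
- move=> t; rewrite in_itv /= => /andP[at_ _]; rewrite derive1E.
  by have [_ ->] := is_derive_powR r (lt_trans a0 at_).
- by apply: within_continuous_itv_gt0 => // t _; exact: continuous_expRN.
- by apply: LR => t _; have [] := dexp t.
- by move=> t _; rewrite derive1E; have [_ ->] := dexp t.
Qed.

(** The open half line is exhausted by the segments [[1 / (k + 1), k + 1]], on which
    the integrand is continuous. *)
Lemma euler_integral_cvg r :
  (\int[mu]_(t in `[k.+1%:R^-1%R, k.+1%:R]) (euler_integrand r t)%:E @[k --> \oo]
    --> euler_integral r)%E.
Proof.
have -> : euler_integral r =
    (\int[mu]_(t in \bigcup_k [set` `[k.+1%:R^-1%R, k.+1%:R]]) (euler_integrand r t)%:E)%E.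
  rewrite /euler_integral; congr (integral _ _ _); apply/seteqP; split=> t /=.
    rewrite in_itv /= andbT => t0.
    exists (maxn (Num.truncn t) (Num.truncn t^-1)) => //=.
    have tt := truncnS_gt t; have ti := truncnS_gt t^-1.
    rewrite in_itv /=; apply/andP; split.
      rewrite -[leRHS]invrK lef_pV2 ?posrE ?ltr0n ?invr_gt0 //.
      by apply: le_trans (ltW ti) _; rewrite ler_nat ltnS leq_maxr.
    by apply: le_trans (ltW tt) _; rewrite ler_nat ltnS leq_maxl.
  move=> [k _]; rewrite /= !in_itv /= andbT => /andP[kt _].
  by apply: lt_le_trans kt; rewrite invr_gt0 ltr0n.
apply: ge0_nondecreasing_set_cvg_integral => //.
- apply/nondecreasing_seqP => k; rewrite subsetEset; apply: subset_itv; rewrite bnd_simp.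
    by rewrite lef_pV2 ?posrE ?ltr0n // ler_nat.
  by rewrite ler_nat.
- by move=> k; apply/measurable_EFinP; exact: measurable_euler_integrand.
- by move=> k t _; rewrite lee_fin euler_integrand_ge0.
Qed.

(** The maximum of [t ^ r * expR (- t / 2)] is at [t = 2 * r]. *)
Lemma powR_le_expR (r t : R) : 0 < r -> 0 < t ->
  t `^ r <= expR (r * ln (2 * r)) * expR (t / 2).
Proof.
move=> r0 t0; have r20 : 0 < 2 * r by rewrite mulr_gt0.
rewrite -expRD /powR gt_eqF // ler_expR.
have -> : ln t = ln (t / (2 * r)) + ln (2 * r).
  by rewrite -lnM ?posrE ?divr_gt0 // divfK // gt_eqF.
rewrite mulrDr addrC lerD2l; apply: (@le_trans _ _ (r * (t / (2 * r)))).
  by rewrite ler_pM2l // ltW // ln_sublinear // divr_gt0.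
by rewrite le_eqVlt; apply/orP; left; apply/eqP; field; rewrite gt_eqF.
Qed.

Lemma euler_integralS r : 0 < r -> euler_integral (r + 1) = (r%:E * euler_integral r)%E.
Proof.
move=> r0.
pose bnd (k : nat) : R :=
  k.+1%:R^-1 `^ r * expR (- k.+1%:R^-1) - k.+1%:R `^ r * expR (- k.+1%:R).
have bnd0 : bnd k @[k --> \oo] --> (0 : R).
  rewrite [X in _ --> X](_ : _ = 0 - 0); last by rewrite subrr.
  apply: cvgB.
    have inv0 : k.+1%:R^-1 `^ r @[k --> \oo] --> (0 : R).
      have /cvg_at_rightP := powR_cvg0 r0; apply; split; last exact: cvg_harmonic.
      by move=> k; rewrite invr_gt0 ltr0n.
    apply: (squeeze_cvgr _ (cvg_cst 0) inv0); apply: nearW => k.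
    by rewrite mulr_ge0 ?powR_ge0 ?expR_ge0 //= ler_piMr ?powR_ge0 ?expR_le1 ?oppr_le0 ?invr_ge0.
  have dec : expR (r * ln (2 * r)) * expR (- (k.+1%:R / 2)) @[k --> \oo] --> (0 : R).
    rewrite [X in _ --> X](_ : _ = expR (r * ln (2 * r)) * 0); last by rewrite mulr0.
    apply: cvgM; first exact: cvg_cst.
    apply: (cvg_comp (fun k : nat => k.+1%:R / 2) (fun t : R => expR (- t))); last exact: cvgr_expR.
    apply/cvgryPge => B; near=> k; rewrite ler_pdivlMr //.
    by apply: (@le_trans _ _ k%:R); [near: k; exact: nbhs_infty_ger|rewrite ler_nat].
  apply: (squeeze_cvgr _ (cvg_cst 0) dec); apply: nearW => k.
  rewrite mulr_ge0 ?powR_ge0 ?expR_ge0 //=.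
  have -> : - (k.+1%:R / 2) = k.+1%:R / 2 - k.+1%:R :> R by field.
  by rewrite [in leRHS]expRD mulrA ler_wpM2r ?expR_ge0 // powR_le_expR.
have lim1 : ((bnd k)%:E + r%:E * \int[mu]_(t in `[k.+1%:R^-1%R, k.+1%:R]) (euler_integrand r t)%:E)%E
    @[k --> \oo] --> (0%:E + r%:E * euler_integral r)%E.
  apply: cvgeD.
  - by rewrite fin_num_adde_defr.
  - by apply: cvg_EFin; [exact: nearW|exact: bnd0].
  - by apply: cvgeZl => //; exact: euler_integral_cvg.
have lim2 := @euler_integral_cvg (r + 1).
have {}lim1 : (\int[mu]_(t in `[k.+1%:R^-1%R, k.+1%:R]) (euler_integrand (r + 1) t)%:E)%E
    @[k --> \oo] --> (0%:E + r%:E * euler_integral r)%E.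
  apply: cvg_trans lim1; apply: near_eq_cvg; exists 1%N => // -[//|k] _ /=.
  have inv_gt0 : 0 < k.+2%:R^-1 :> R by rewrite invr_gt0 ltr0n.
  have inv_lt : k.+2%:R^-1 < k.+2%:R :> R.
    by apply: (@lt_trans _ _ 1); [rewrite invf_lt1 ?ltr0n // ltr1n|rewrite ltr1n].
  by rewrite (euler_integral_by_parts r inv_gt0 inv_lt).
by rewrite -[RHS]add0e; apply: cvg_unique lim2 lim1.
Unshelve. all: by end_near. Qed.

Lemma euler_integral_gt0 r : (0 < euler_integral r)%E.
Proof.
pose c := expR (- (`|r - 1| * 2) - 2).
apply: (@lt_le_trans _ _ (\int[mu]_(t in `[1%R, 2%R]) c%:E)%E).
  rewrite integral_cst //= lebesgue_measure_itv /= lte_fin ltr1n -EFinB -EFinM lte_fin.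
  by rewrite mulr_gt0 ?expR_gt0 //; lra.
apply: (@le_trans _ _ (\int[mu]_(t in `[1%R, 2%R]) (euler_integrand r t)%:E)%E).
  apply: ge0_le_integral => //.
  - by move=> t _; rewrite lee_fin expR_ge0.
  - by apply/measurable_EFinP; exact: measurable_euler_integrand.
  - move=> t /=; rewrite in_itv /= lee_fin => /andP[t1 t2].
    have t0 : 0 < t by lra.
    rewrite /euler_integrand /powR gt_eqF // -expRD ler_expR.
    have lnt0 : 0 <= ln t by exact: ln_ge0.
    have lnt2 : ln t <= 2 by apply: le_trans t2; apply: ltW; exact: ln_sublinear.
    have : `|(r - 1) * ln t| <= `|r - 1| * 2.
      by rewrite normrM (ger0_norm lnt0) ler_wpM2l.
    rewrite ler_norml => /andP[+ _]; lra.
apply: ge0_subset_integral => //.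
- by apply/measurable_EFinP; exact: measurable_euler_integrand.
- by move=> t _; rewrite lee_fin euler_integrand_ge0.
- by move=> t /=; rewrite !in_itv /= andbT => /andP[t1 _]; exact: lt_le_trans t1.
Qed.

(** For small [r] the integrand is not bounded at [0]; the functional equation
    reduces finiteness to the argument [r + 1]. *)
Lemma euler_integral_lty r : 0 < r -> (euler_integral r < +oo)%E.
Proof.
move=> r0; suff : (euler_integral (r + 1) < +oo)%E.
  rewrite euler_integralS //; case: (euler_integral r) (euler_integral_gt0 r) => [x||] //.
    by move=> _ _; exact: ltry.
  by move=> _; rewrite gt0_muley.
pose C := expR (r * ln (2 * r)).
apply: (@le_lt_trans _ _ (\int[mu]_(t in `[0%R, +oo[) (C * expR (- t / 2))%:E)%E).
  apply: (@le_trans _ _ (\int[mu]_(t in `]0%R, +oo[) (C * expR (- t / 2))%:E)%E).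
    apply: ge0_le_integral => //.
    - by move=> t _; rewrite lee_fin euler_integrand_ge0.
    - by apply/measurable_EFinP; exact: measurable_euler_integrand.
    - apply/measurable_EFinP; apply: measurable_funM => //.
      by apply: measurable_funTS; apply: measurableT_comp => //; exact: measurable_funM.
    - move=> t /=; rewrite in_itv /= andbT lee_fin => t0.
      rewrite /euler_integrand addrK.
      have -> : expR (- t / 2) = expR (t / 2) * expR (- t).
        by rewrite -expRD; congr expR; field.
      by rewrite mulrA ler_wpM2r ?expR_ge0 // powR_le_expR.
  apply: ge0_subset_integral => //.
  - apply/measurable_EFinP; apply: measurable_funM => //.
    by apply: measurable_funTS; apply: measurableT_comp => //; exact: measurable_funM.
  - by move=> t _; rewrite lee_fin mulr_ge0 ?expR_ge0.
  - by move=> t /=; rewrite !in_itv /= !andbT => /ltW.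
pose F (t : R) := - (2 * C * expR (- t / 2)).
have dF (t : R) : is_derive t (1 : R) F (C * expR (- t / 2)).
  by apply: is_derive_eq; rewrite /GRing.scale /=; field.
rewrite (@ge0_continuous_FTC2y R (fun t => C * expR (- t / 2)) F 0 0).
- by rewrite -EFinB ltry.
- by move=> t _; rewrite mulr_ge0 ?expR_ge0.
- apply: continuous_subspaceT => t; apply: cvgM; first exact: cvg_cst.
  apply: continuous_comp; last exact: continuous_expR.
  by apply: cvgM; [exact: opp_continuous|exact: cvg_cst].
- rewrite /F [X in _ --> X](_ : _ = - (2 * C * 0)); last by rewrite mulr0 oppr0.
  apply: cvgN; apply: cvgM; first exact: cvg_cst.
  rewrite (_ : (fun t : R => expR (- t / 2)) = (fun t : R => expR (- t)) \o (fun t : R => t / 2)); last first.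
    by apply/funext => t /=; rewrite mulNr.
  apply: cvg_comp; last exact: cvgr_expR.
  by apply: gt0_cvgMly => //; exact: cvg_id.
- by move=> t _; have [] := dF t.
- apply: cvg_at_right_filter; apply: derivable_continuous_at; by have [] := dF 0.
- by move=> t _; rewrite derive1E; have [_ ->] := dF t.
Qed.

Lemma euler_integralE r : 0 < r -> euler_integral r = (Gamma r)%:E.
Proof.
move=> r0; rewrite /Gamma /Rintegral fineK // ge0_fin_numE; first exact: euler_integral_lty.
exact: ltW (euler_integral_gt0 r).
Qed.

Lemma Gamma_gt0 (r : R) : 0 < r -> 0 < Gamma r.
Proof. by move=> r0; rewrite -lte_fin -euler_integralE // euler_integral_gt0. Qed.

Lemma GammaS (r : R) : 0 < r -> Gamma (r + 1) = r * Gamma r.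
Proof.
move=> r0; apply: EFin_inj; rewrite -euler_integralE ?addr_gt0 // euler_integralS //.
by rewrite euler_integralE.
Qed.

End GammaFunction.

(** The functional equation of Gamma, in the numerator and in the denominator. *)
Lemma erw_a_normalizing (R : realType) (p : R) : 0 < p -> p <= 3 / 4 ->
  normalizing (2 * p - 1) (erw_a p).
Proof.
move=> p0 p34; have pos n : (0 < n)%N -> 0 < n%:R + 2 * p - 1.
  by move=> n0; have : 1 <= n%:R :> R by [rewrite (ler_nat R 1)]; lra.
split; [lra|lra| |].
  move=> [//|n] _; rewrite /erw_a /= divr_gt0 // Gamma_gt0 // ?ltr0n //; exact: pos.
move=> [//|n] _; rewrite /erw_a /=.
have -> : n.+2%:R + 2 * p - 1 = (n.+1%:R + 2 * p - 1) + 1 by rewrite -[n.+2%:R]natr1; ring.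
rewrite -[n.+2%:R]natr1 !GammaS ?ltr0n // ?pos //.
have g1 : Gamma (n.+1%:R + 2 * p - 1) != 0 by rewrite gt_eqF // Gamma_gt0 // pos.
have k1 : n.+1%:R + 2 * p - 1 != 0 by rewrite gt_eqF // pos.
have -> : n.+1%:R + (2 * p - 1) = n.+1%:R + 2 * p - 1 by ring.
move: (Gamma (_ - 1)) g1 => g g0; move: (_ - 1) k1 => k k0; move: (Gamma _) => G.
by move: (n.+1%:R : R) => N; field; rewrite k0 g0.
Qed.

(** * Paths of signs *)
Lemma lt_first_zero_after (R : realType) (f : nat -> R) (m N : nat) :
  (N%:R%:E < first_zero_after f m)%E <-> (forall k, (0 < k <= N)%N -> f (m + k)%N != 0).
Proof.
split=> [lt k /andP[k0 kN]|nz].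
  apply/eqP => fk; suff : (first_zero_after f m <= N%:R%:E)%E by rewrite leNgt lt.
  apply: (@le_trans _ _ (k%:R%:E)); last by rewrite lee_fin ler_nat.
  by apply: ereal_inf_lbound; exists k.
apply: (@lt_le_trans _ _ (N.+1%:R%:E)); first by rewrite lte_fin ltr_nat.
apply: le_ereal_inf_tmp => _ [k [k0 fk] <-]; rewrite lee_fin ler_nat ltnNge.
by apply/negP => kN; have := nz k; rewrite k0 kN fk eqxx => /(_ isT).
Qed.

Section SignPaths.

Definition signz (c : bool) : int := if c then 1 else -1.

(** A path is the list of its steps, the latest one first, so that adding a step is
    [cons]. *)
Definition endpoint (s : seq bool) : int := \sum_(c <- s) signz c.

Fixpoint sign_paths (n : nat) : seq (seq bool) :=
  if n is n'.+1 then map (cons true) (sign_paths n') ++ map (cons false) (sign_paths n')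
  else [:: [::]].

(** The path is at [y] at time [m] and avoids [0] afterwards. *)
Fixpoint alive (m : nat) (y : int) (s : seq bool) : bool :=
  if size s == m then endpoint s == y
  else if s is _ :: s' then alive m y s' && (endpoint s != 0) else false.

Lemma big_sign_pathsS (R : realType) n (F : seq bool -> R) (Q : pred (seq bool)) :
  \sum_(s <- sign_paths n.+1 | Q s) F s =
  \sum_(s <- sign_paths n) \sum_(c : bool | Q (c :: s)) F (c :: s).
Proof.
rewrite /= big_cat /= !big_map [LHS]addrC.
rewrite [X in X + _]big_mkcond [X in _ + X]big_mkcond -big_split /=.
by apply: eq_bigr => s _; rewrite [RHS]big_mkcond big_bool /= addrC.
Qed.

Lemma size_sign_paths n s : s \in sign_paths n -> size s = n.
Proof.
elim: n s => [|n IH] s /=; first by rewrite inE => /eqP ->.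
by rewrite mem_cat => /orP[] /mapP[s' /IH <- ->].
Qed.

Lemma endpoint_cons c s : endpoint (c :: s) = signz c + endpoint s.
Proof. by rewrite /endpoint big_cons. Qed.

Lemma endpoint_norm_le s : (`|endpoint s| <= size s)%N.
Proof.
elim: s => [|c s IH]; first by rewrite /endpoint big_nil.
rewrite endpoint_cons /=; case: c; rewrite /signz; lia.
Qed.

Lemma alive_neq0 m y s : y != 0 -> alive m y s -> endpoint s != 0.
Proof.
move=> y0; case: s => [|c s] /=; case: ifP => _ //; first by move/eqP => ->.
  by move/eqP => ->.
by case/andP.
Qed.

Lemma alive_cons m y c s : (m <= size s)%N ->
  alive m y (c :: s) = alive m y s && (endpoint (c :: s) != 0).
Proof. by move=> ms; rewrite /= gtn_eqF // ltnS. Qed.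

End SignPaths.

(** * The law of the paths of the elephant *)
Section PathProbabilities.
Context d (T : measurableType d) (R : realType) (P : probability T R) (p q : R).
Context (X : nat -> {RV P >-> R}) (U : nat -> {RV P >-> nat}) (coin : nat -> {RV P >-> bool}).
Implicit Types (hw : elephant_random_walk p q X U coin) (s : seq bool) (c : bool).

Definition sign c : R := (signz c)%:~R.

Fixpoint path_event s : set T :=
  if s is c :: s' then path_event s' `&` [set t | X (size s').+1 t = sign c] else setT.

Lemma measurable_eq_value d' (T' : measurableType d') (Z : {RV P >-> T'}) (z : T') :
  measurable [set z] -> measurable [set t | Z t = z].
Proof.
by move=> mz; exact: (measurable_funPTI Z mz).
Qed.

Lemma measurable_X n (x : R) : measurable [set t | X n t = x].
Proof. exact: measurable_eq_value. Qed.

Lemma measurable_U n k : measurable [set t | U n t = k].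
Proof. exact: measurable_eq_value. Qed.

Lemma measurable_coin n b : measurable [set t | coin n t = b].
Proof. exact: measurable_eq_value. Qed.

Lemma measurable_path_event s : measurable (path_event s).
Proof.
by elim: s => [|c s IH] //=; apply: measurableI => //; exact: measurable_X.
Qed.

Lemma path_event_nth s t j : path_event s t -> (j < size s)%N ->
  X (size s - j)%N t = sign (nth false s j).
Proof.
by elim: s j => [|c s IH] [|j] //= [ps Xc] js; rewrite ?subn0 // subSS; exact: IH.
Qed.

Lemma sign_inj c c' : sign c = sign c' -> c = c'.
Proof.
by case: c; case: c' => //; rewrite /sign /signz => /eqP; rewrite eqr_int.
Qed.

Lemma signN c : - sign c = sign (~~ c).
Proof. by case: c; rewrite /sign /signz -mulrNz ?opprK. Qed.

(** Summing to [1] is all that is known of the events [V j]: they cover the space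
    up to a null set only. *)
Lemma probability_split n (V : 'I_n -> set T) (A : set T) :
  (forall j, measurable (V j)) -> trivIset setT V -> (\sum_(j < n) P (V j) = 1)%E ->
  measurable A -> P A = (\sum_(j < n) P (A `&` V j))%E.
Proof.
move=> mV trivV sumV mA; pose W := \big[setU/set0]_(j < n) V j.
have mW : measurable W by apply: bigsetU_measurable => j _; exact: mV.
have PW : P W = 1%E by rewrite measure_bigsetU_ord.
have PC : P (~` W) = 0%E by rewrite probability_setC // PW subee.
have PAW0 : P (A `\` W) = 0%E.
  apply: (@subset_measure0 _ _ _ P _ (~` W)).
  - exact: measurableD.
  - exact: measurableC.
  - by move=> t [].
  - exact: PC.
transitivity (P (A `\` W) + P (A `&` W))%E; first exact: measureDI.
rewrite PAW0 add0e /W big_distrr /= measure_bigsetU_ord //.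
- by move=> j; exact: measurableI.
- by move=> i j _ _ [t [[_ Vi] [_ Vj]]]; apply: trivV => //; exists t.
Qed.

Lemma memory_split hw n (A : set T) : (0 < n)%N -> measurable A ->
  P A = (\sum_(j < n) P (A `&` [set t | U n t = (n - j)%N]))%E.
Proof.
move=> n0; apply: probability_split => [j||]; first exact: measurable_U.
  move=> i j _ _ [t []] /= -> ij; apply: val_inj => /=.
  by have := ltn_ord i; have := ltn_ord j; lia.
rewrite (eq_bigr (fun=> (n%:R^-1)%:E)) => [|j _]; last first.
  apply: (erw_memory hw); rewrite subn_gt0 ltn_ord /=; exact: leq_subr.
rewrite sumEFin sumr_const card_ord -[_ *+ n]mulr_natr mulVf //.
by rewrite pnatr_eq0 -lt0n.
Qed.

Lemma step_event s c n j t : size s = n -> (0 < n)%N -> (j < n)%N ->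
  elephant_random_walk p q X U coin ->
  path_event s t -> U n t = (n - j)%N ->
  (X n.+1 t = sign c) <-> (coin n t = (nth false s j == c)).
Proof.
move=> sn n0 jn hw ps Un; rewrite (erw_step hw n0) Un -sn (path_event_nth ps) ?sn //.
case: (coin n t); rewrite ?signN; split.
- by move/sign_inj => ->; rewrite eqxx.
- by move/esym/eqP => ->.
- by move/sign_inj => <-; case: (nth _ _ _).
- by move/esym; case: (nth _ _ _); case: c.
Qed.

Lemma step_split hw s c (A : set T) : (0 < size s)%N -> measurable A ->
  P (A `&` path_event (c :: s)) = (\sum_(j < size s)
    P (A `&` path_event s `&` [set t | U (size s) t = (size s - j)%N]
         `&` [set t | coin (size s) t = (nth false s j == c)]))%E.
Proof.
move=> s0 mA; rewrite (memory_split hw s0); last first.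
  by apply: measurableI => //; exact: measurable_path_event.
apply: eq_bigr => j _; congr (P _); apply/seteqP; split=> t /=.
- move=> [[At [ps Xt]] Ut]; do !split => //.
  by apply/(step_event c erefl s0 (ltn_ord j) hw ps Ut).
- move=> [[[At ps] Ut] ct]; do !split => //.
  by apply/(step_event c erefl s0 (ltn_ord j) hw ps Ut).
Qed.

Lemma first_step_split hw (A : set T) : measurable A ->
  P A = (\sum_(c : bool) P (A `&` path_event [:: c]))%E.
Proof.
move=> mA; have := @probability_split 2 (fun j => [set t | X 1 t = sign (j == 0 :> nat)]) A.
rewrite !big_ord_recl !big_ord0 /= !adde0 big_bool /= !setTI; apply=> //.
- by move=> j; exact: measurable_X.
- move=> i j _ _ [t []] /= -> /sign_inj ij; apply: val_inj => /=.
  by move: ij; case: i => -[|[]] //= ?; case: j => -[|[]].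
- rewrite (erw_first_pos hw) -[sign false]/(-1)%:~R mulrNz (erw_first_neg hw).
  by rewrite -EFinD addrCA subrr addr0.
Qed.

(** The sources of randomness used after time [n]; the source [Some (inl k)] or
    [Some (inr k)] acts on the step from time [k.+1] to time [k.+2]. *)
Definition future (n : nat) (i : option (nat + nat)) : bool :=
  match i with
  | None => false
  | Some (inl k) => (n <= k.+1)%N
  | Some (inr k) => (n <= k.+1)%N
  end.

(** The event is quantified over all finite families of future sources, since each
    further step of the path uses two of them. *)
Definition independent_of_future s := forall (J : seq (option (nat + nat))) E,
  uniq J -> {in J, forall i, future (size s) i} ->
  {in J, forall i, erw_randomness X U coin i (E i)} ->
  P (\big[setI/setT]_(i <- J) E i `&` path_event s) =
    (P (path_event s) * \prod_(i <- J) P (E i))%E.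

Definition coin_weight (b : bool) : R := if b then p else 1 - p.

(** The probability that the step after [s] is [c]: choose an entry [e] of [s]
    uniformly, then repeat it with probability [p]. *)
Definition next_weight s c : R :=
  (size s)%:R^-1 * \sum_(e <- s) coin_weight (e == c).

Lemma randomness_measurable i (E : set T) : erw_randomness X U coin i E -> measurable E.
Proof.
by case: i => [[k|k]|] [B mB <-]; rewrite setTI; exact: measurable_funPTI.
Qed.

Lemma measurable_bigI_randomness (J : seq (option (nat + nat))) (E : option (nat + nat) -> set T) :
  {in J, forall i, erw_randomness X U coin i (E i)} ->
  measurable (\big[setI/setT]_(i <- J) E i).
Proof.
move=> JE; rewrite big_seq; apply: bigsetI_measurable => i iJ.
exact: randomness_measurable (JE i iJ).
Qed.

Lemma coin_weightE hw n b : (0 < n)%N -> P [set t | coin n t = b] = (coin_weight b)%:E.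
Proof.
move=> n0; case: b; first exact: (erw_coin hw).
have -> : [set t | coin n t = false] = ~` [set t | coin n t = true].
  by apply/seteqP; split => t /=; case: (coin n t).
by rewrite probability_setC ?(erw_coin hw n0) // ; exact: measurable_coin.
Qed.

Lemma bigI_indep hw (J : seq (option (nat + nat))) (E : option (nat + nat) -> set T) :
  uniq J -> {in J, forall i, erw_randomness X U coin i (E i)} ->
  P (\big[setI/setT]_(i <- J) E i) = (\prod_(i <- J) P (E i))%E.
Proof. by move=> uJ JE; rewrite -bigcap_seq; exact: (erw_indep hw). Qed.

Lemma eq_randomness_extend (J : seq (option (nat + nat))) i0 (B : set T)
    (E : option (nat + nat) -> set T) : i0 \notin J ->
  let E' i := if i == i0 then B else E i in
  (\big[setI/setT]_(i <- J) E' i = \big[setI/setT]_(i <- J) E i) *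
  ((\prod_(i <- J) P (E' i))%E = (\prod_(i <- J) P (E i))%E).
Proof.
move=> i0J E'; have EE i : i \in J -> E' i = E i.
  by move=> iJ; rewrite /E'; case: eqP => // ii0; move: i0J; rewrite -ii0 iJ.
by split; apply: eq_big_seq => i /EE ->.
Qed.

Lemma independent_of_future1 hw c : independent_of_future [:: c].
Proof.
move=> J E uJ fJ JE /=; rewrite setTI.
have NJ : None \notin J by apply/negP => /fJ.
pose B := [set t | X 1 t = sign c].
have [e1 e2] := eq_randomness_extend B E NJ.
pose E' i := if i == None then B else E i.
have := @bigI_indep hw (None :: J) E'; rewrite /= NJ uJ => /(_ isT).
rewrite !big_cons e1 e2 setIC /= -/B; apply => i.
rewrite inE => /orP[/eqP ->|iJ]; rewrite /E' ?eqxx /=.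
  by exists [set sign c] => //; rewrite setTI.
by case: eqP => [i0|_]; [move: NJ; rewrite -i0 iJ|exact: JE].
Qed.

(** Decompose according to the value of the memory variable; once it is known, the
    new step is determined by the coin. Both are future sources for [s], and they
    are not among the sources in [J]. *)
Lemma independent_step hw s c (J : seq (option (nat + nat))) E : (0 < size s)%N ->
  independent_of_future s -> uniq J -> {in J, forall i, future (size s).+1 i} ->
  {in J, forall i, erw_randomness X U coin i (E i)} ->
  P (\big[setI/setT]_(i <- J) E i `&` path_event (c :: s)) =
    (P (path_event s) * (next_weight s c)%:E * \prod_(i <- J) P (E i))%E.
Proof.
move=> s0 indep uJ fJ JE.
have mA := measurable_bigI_randomness JE; set A := \big[setI/setT]_(i <- J) E i in mA *.
rewrite (step_split hw c s0 mA).
pose iU : option (nat + nat) := Some (inl (size s).-1).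
pose ic : option (nat + nat) := Some (inr (size s).-1).
have Uc : iU != ic by [].
have UJ : iU \notin J by apply/negP => /fJ; rewrite /= prednK // ltnn.
have cJ : ic \notin J by apply/negP => /fJ; rewrite /= prednK // ltnn.
have term (j : 'I_(size s)) :
    P (A `&` path_event s `&` [set t | U (size s) t = (size s - j)%N]
        `&` [set t | coin (size s) t = (nth false s j == c)]) =
    (P (path_event s) * ((size s)%:R^-1 * coin_weight (nth false s j == c))%:E *
      \prod_(i <- J) P (E i))%E.
  pose BU := [set t | U (size s) t = (size s - j)%N].
  pose Bc := [set t | coin (size s) t = (nth false s j == c)].
  pose E1 i := if i == ic then Bc else E i.
  pose E2 i := if i == iU then BU else E1 i.
  have := indep (iU :: ic :: J) E2.
  rewrite /= !inE negb_or Uc UJ cJ uJ /= => /(_ isT).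
  have [a1 a2] := eq_randomness_extend Bc E cJ.
  have [b1 b2] := eq_randomness_extend BU E1 UJ.
  rewrite !big_cons b1 b2 a1 a2 /E2 eqxx /E1 /= eqxx -/A.
  have PU : P BU = ((size s)%:R^-1)%:E.
    by apply: (erw_memory hw); rewrite subn_gt0 ltn_ord /= leq_subr.
  rewrite PU (coin_weightE hw) // => H.
  transitivity (P (BU `&` (Bc `&` A) `&` path_event s)).
    by congr (P _); rewrite -/BU -/Bc; apply/seteqP; split => t /=; tauto.
  rewrite {}H.
  - by rewrite EFinM !muleA.
  - move=> i; rewrite !inE => /or3P[/eqP ->|/eqP ->|/fJ] /=; rewrite ?prednK //.
    by case: i => [[k|k]|] //= /ltnW.
  - move=> i; rewrite !inE => /or3P[/eqP ->|/eqP ->|iJ].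
    + by rewrite eqxx /= prednK //; exists [set (size s - j)%N] => //; rewrite setTI.
    + by rewrite /= eqxx /= prednK //; exists [set (nth false s j == c)] => //; rewrite setTI.
    + by case: eqP => [i0|_]; [move: UJ; rewrite -i0 iJ|case: eqP => [i0|_];
        [move: cJ; rewrite -i0 iJ|exact: JE]].
rewrite (eq_bigr _ (fun j _ => term j)).
have -> : (\prod_(i <- J) P (E i) = (fine (P A))%:E)%E.
  by rewrite fineK ?fin_num_measure // /A (bigI_indep hw).
rewrite -[P (path_event s)]fineK ?fin_num_measure //; last exact: measurable_path_event.
under eq_bigr => j _ do rewrite -!EFinM.
rewrite sumEFin -!EFinM; congr EFin.
rewrite /next_weight (big_nth false) big_mkord !mulr_sumr mulr_suml.
by apply: eq_bigr => j _.
Qed.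

Lemma independent_of_futureP hw s : (0 < size s)%N -> independent_of_future s.
Proof.
elim: s => // c [|c' s] IH _; first exact: independent_of_future1.
move=> J E uJ fJ JE; have {}IH := IH isT; rewrite (independent_step hw) //.
have := @independent_step hw (c' :: s) c [::] E isT IH isT.
rewrite !big_nil setTI mule1 => -> //.
Qed.

Definition path_prob s : R := fine (P (path_event s)).

Lemma path_prob_ge0 s : 0 <= path_prob s.
Proof. exact: fine_ge0. Qed.

Lemma path_prob_cons hw s c : (0 < size s)%N ->
  path_prob (c :: s) = path_prob s * next_weight s c.
Proof.
move=> s0; have := @independent_step hw s c [::] (fun=> setT) s0 (independent_of_futureP hw s0) isT.
rewrite !big_nil setTI mule1 /path_prob => -> //.
rewrite -[X in (X * _)%E]fineK ?fin_num_measure //; exact: measurable_path_event.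
Qed.

(** Only the sum of the past steps matters, which is the Markov property of the
    position. *)
Lemma next_weightE s c : (0 < size s)%N ->
  next_weight s c = (1 + sign c * ((2 * p - 1) * (endpoint s)%:~R / (size s)%:R)) / 2.
Proof.
move=> s0; rewrite /next_weight.
have -> : \sum_(e <- s) coin_weight (e == c) =
    ((size s)%:R + sign c * (2 * p - 1) * (endpoint s)%:~R) / 2.
  elim: s {s0} => [|e s IH]; first by rewrite /endpoint !big_nil mulr0 addr0 mul0r.
  have -> : (size (e :: s))%:R = (size s)%:R + 1 :> R by rewrite natr1.
  rewrite big_cons IH endpoint_cons intrD.
  have -> : coin_weight (e == c) = (1 + sign c * (2 * p - 1) * sign e) / 2.
    have N1 : (-1 : int)%:~R = -1 :> R by rewrite mulrNz.
    by case: e; case: c {IH} => /=; rewrite /sign /signz ?N1; field.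
  by rewrite /sign; field.
have n0 : (size s)%:R != 0 :> R by rewrite pnatr_eq0 -lt0n.
by move: ((size s)%:R : R) n0 (sign c) ((endpoint s)%:~R : R) => n n0 x y; field.
Qed.

(** That a step is [1] or [-1] almost surely follows from the same property of the
    past steps, by splitting along the memory variable and the coin. *)
Lemma next_step_split hw s (A : set T) : (0 < size s)%N -> measurable A ->
  P (A `&` path_event s) = (\sum_(c : bool) P (A `&` path_event (c :: s)))%E.
Proof.
move=> s0 mA; rewrite big_bool.
transitivity (P (A `&` path_event (true :: s)) + P (A `&` path_event (false :: s)))%E => //.
rewrite !(step_split hw _ s0 mA) -big_split (memory_split hw s0) /=; last first.
  by apply: measurableI => //; exact: measurable_path_event.
apply: eq_bigr => j _; set B := _ `&` _ `&` _.
have mB : measurable B.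
  by do !apply: measurableI => //; [exact: measurable_path_event|exact: measurable_U].
have split_coin : P B = (P (B `&` [set t | coin (size s) t = true]) +
    P (B `&` [set t | coin (size s) t = false]))%E.
  rewrite (measureDI P mB (measurable_coin (size s) true)) addeC; congr (_ + P _)%E.
  by apply/seteqP; split => t [Bt]; move=> ct; split=> //; move: ct => /=;
    case: (coin (size s) t).
by rewrite split_coin; case: (nth false s j) => //=; rewrite addeC.
Qed.

Lemma path_total hw n (A : set T) : (0 < n)%N -> measurable A ->
  fine (P A) = \sum_(s <- sign_paths n) fine (P (A `&` path_event s)).
Proof.
have fin B : measurable B -> P B \is a fin_num by move=> mB; exact: fin_num_measure.
case: n => // n _ mA; elim: n => [|n IH].
  rewrite (first_step_split hw mA) big_bool /= !big_cons big_nil addr0 /=.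
  by rewrite fineD ?fin //; apply: measurableI => //; exact: (measurable_path_event [:: _]).
rewrite {}IH [RHS](@big_sign_pathsS R n.+1 _ xpredT); apply: eq_big_seq => s sn.
rewrite (next_step_split hw) ?(size_sign_paths sn) // !big_bool.
by rewrite fineD ?fin //; apply: measurableI => //; exact: (measurable_path_event (_ :: _)).
Qed.

Lemma erw_position_path s t : path_event s t -> erw_position X (size s) t = (endpoint s)%:~R.
Proof.
rewrite /erw_position /endpoint; elim: s => [|c s IH] /=.
  by rewrite big_geq // big_nil.
by case=> ps Xc; rewrite big_nat_recr //= IH // Xc big_cons intrD addrC.
Qed.

Definition alive_event m (y : int) N : set T :=
  [set t | erw_position X m t = y%:~R /\
    forall k, (0 < k <= N)%N -> erw_position X (m + k)%N t != 0].

Lemma path_event_alive m y N s t : size s = (m + N)%N -> path_event s t ->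
  alive m y s <-> alive_event m y N t.
Proof.
elim: N s => [|N IH] s.
  rewrite addn0 => sm ps; have pos := erw_position_path ps; rewrite sm in pos.
  have -> : alive m y s = (endpoint s == y) by case: s sm {ps pos} => [|c s] /= ->; rewrite eqxx.
  rewrite /alive_event /= pos; split; first by move/eqP => ->; split=> // k; lia.
  by case=> /eqP; rewrite eqr_int.
case: s => [|c s]; first by rewrite addnS.
rewrite addnS => -[sm] pcs; have [ps _] := pcs.
rewrite alive_cons ?sm ?leq_addr //.
have pos := erw_position_path pcs; rewrite /= sm -addnS in pos.
split.
  case/andP => /(IH _ sm ps) [Xm nz] e0; split=> // k /andP[k0 kN].
  have [kN'|Nk] := leqP k N; first by apply: nz; rewrite k0.
  have -> : k = N.+1 by lia.
  by rewrite pos intr_eq0.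
case=> Xm nz; apply/andP; split.
  by apply/(IH _ sm ps); split=> // k kN; apply: nz; lia.
by rewrite -(intr_eq0 R) -pos nz //=.
Qed.

Lemma measurable_position n : measurable_fun setT (erw_position X n).
Proof. exact: measurable_sum. Qed.

Lemma measurable_alive_event m y N : measurable (alive_event m y N).
Proof.
have -> : alive_event m y N = (erw_position X m @^-1` [set y%:~R]) `&`
    \bigcap_(k in [set k | (0 < k <= N)%N]) (erw_position X (m + k)%N @^-1` (~` [set 0])).
  apply/seteqP; split=> t /=; case=> Xm nz; split=> // k kN; first by apply/eqP; exact: nz.
  by apply/eqP; exact: nz.
apply: measurableI.
  by rewrite -[X in measurable X]setTI; apply: measurable_position.
apply: bigcap_measurableType => k _.
rewrite -[X in measurable X]setTI; apply: measurable_position => //.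
exact: measurableC.
Qed.

Lemma prob_alive_event hw m y N : (0 < m + N)%N ->
  fine (P (alive_event m y N)) = \sum_(s <- sign_paths (m + N) | alive m y s) path_prob s.
Proof.
move=> mN; rewrite (path_total hw mN (measurable_alive_event m y N)) [RHS]big_mkcond.
apply: eq_big_seq => s /size_sign_paths sm; case: ifPn => al.
  congr (fine (P _)); apply/seteqP; split=> t; first by case.
  by move=> ps; split=> //; exact/(path_event_alive y sm ps).
rewrite (_ : _ `&` _ = set0) ?measure0 //.
apply/seteqP; split=> t // -[ea ps]; move/negP: al; apply.
exact/(path_event_alive y sm ps).
Qed.

(** The conditional law of the distance to [0] before the first visit to [0]. *)
Definition walk_weight m y n x : R :=
  (\sum_(s <- sign_paths n | alive m y s && (x == `|endpoint s|%N)) path_prob s) /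
    fine (P (alive_event m y 0)).

Lemma mass_walk_weight m (y : int) n h : y != 0 ->
  mass (walk_weight m y) n h =
  (\sum_(s <- sign_paths n | alive m y s) path_prob s * h `|endpoint s|%N) /
    fine (P (alive_event m y 0)).
Proof.
move=> y0; rewrite /mass /walk_weight.
transitivity (\sum_(1 <= x < n.+1) (\sum_(s <- sign_paths n | alive m y s)
    (if x == `|endpoint s|%N then path_prob s * h x else 0)) / fine (P (alive_event m y 0))).
  apply: eq_bigr => x _; rewrite mulrAC; congr (_ / _).
  by rewrite mulr_suml big_mkcondr.
rewrite -mulr_suml exchange_big /=; congr (_ / _).
rewrite [LHS]big_seq_cond [RHS]big_seq_cond; apply: eq_bigr => s /andP[/size_sign_paths sn al].
rewrite -big_mkcond big_nat1_eq lt0n absz_eq0 (alive_neq0 y0 al) /= ltnS.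
by rewrite -sn endpoint_norm_le.
Qed.

(** A change of sign of the position exchanges the probabilities of the two steps,
    so that the distance to [0] moves according to [mean_next]. *)
Lemma walk_weight_killed hw m (y : int) : y != 0 -> (0 < P (alive_event m y 0))%E ->
  killed_walk (2 * p - 1) m `|y|%N (walk_weight m y).
Proof.
move=> y0 Pm.
have m0 : (0 < m)%N.
  rewrite lt0n; apply/eqP => m0; move: Pm; rewrite m0 (_ : alive_event _ _ _ = set0) ?measure0 ?ltxx //.
  apply/seteqP; split=> t // -[]; rewrite /erw_position big_geq // => /esym /eqP.
  by rewrite intr_eq0 (negPf y0).
have pm0 : 0 < fine (P (alive_event m y 0)).
  by rewrite fine_gt0 // Pm -ge0_fin_numE // fin_num_measure //; exact: measurable_alive_event.
split=> // [n x|h|n h mn h0].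
- by rewrite divr_ge0 // ?fine_ge0 // sumr_ge0 // => s _; exact: path_prob_ge0.
- rewrite mass_walk_weight //.
  have m00 : (0 < m + 0)%N by rewrite addn0.
  have := prob_alive_event hw y m00; rewrite addn0 => pE.
  transitivity ((\sum_(s <- sign_paths m | alive m y s) path_prob s) * h `|y|%N /
      fine (P (alive_event m y 0))).
    congr (_ / _); rewrite mulr_suml [LHS]big_seq_cond [RHS]big_seq_cond.
    apply: eq_bigr => s /andP[/size_sign_paths sm]; case: s sm => [|c s] /= ->;
    by rewrite eqxx => /eqP ->.
  by rewrite -pE mulrAC mulfV ?mul1r // gt_eqF.
rewrite !mass_walk_weight //; congr (_ / _).
rewrite big_sign_pathsS [RHS]big_mkcond; apply: eq_big_seq => s /size_sign_paths sn.
have s0 : (0 < size s)%N by rewrite sn (leq_trans m0).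
have big_boolR (F : bool -> R) : \sum_c F c = F true + F false by rewrite big_bool.
rewrite big_mkcond big_boolR !alive_cons ?sn // !(path_prob_cons hw) //.
have [al|_] := boolP (alive m y s); last exact: addr0.
(* As [h] vanishes at [0], the killed paths contribute nothing. *)
have drop c : (if true && (endpoint (c :: s) != 0) then
    path_prob s * next_weight s c * h `|endpoint (c :: s)|%N else 0) =
    path_prob s * next_weight s c * h `|endpoint (c :: s)|%N.
  by case: eqP => // -> /=; rewrite h0 mulr0.
rewrite !drop -!(mulrA (path_prob s)) -mulrDr; congr (_ * _).
rewrite !next_weightE // sn /mean_next !endpoint_cons /sign /signz mulrNz !mulN1r mul1r.
have en := alive_neq0 y0 al.
have [epos|eneg] := leP 0 (endpoint s).
  have -> : `|(1 + endpoint s)%R|%N = `|endpoint s|.+1 by lia.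
  have -> : `|(-1 + endpoint s)%R|%N = `|endpoint s|.-1 by lia.
  by rewrite natr_absz ger0_norm ?ler0z // mulrA.
have -> : `|(1 + endpoint s)%R|%N = `|endpoint s|.-1 by lia.
have -> : `|(-1 + endpoint s)%R|%N = `|endpoint s|.+1 by lia.
by rewrite natr_absz ltr0_norm ?ltrz0 // mulrNz !(mulrN, mulNr) opprK [LHS]addrC.
Qed.

Lemma survival_walk_weight hw m (y : int) N : y != 0 -> (0 < m + N)%N ->
  survival (walk_weight m y) (m + N) =
  fine (P (alive_event m y N)) / fine (P (alive_event m y 0)).
Proof.
move=> y0 mN; rewrite /survival mass_walk_weight // (prob_alive_event hw y mN).
by congr (_ / _); apply: eq_bigr => s _; rewrite mulr1.
Qed.

End PathProbabilities.

(** * The persistence probability of the elephant *)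
Theorem theorem1p2 (d : measure_display) (T : measurableType d) (R : realType)
    (P : probability T R) (p q : R)
    (X : nat -> {RV P >-> R}) (U : nat -> {RV P >-> nat})
    (coin : nat -> {RV P >-> bool}) (m : nat) (y : int) :
  0 < p -> p <= 3 / 4 -> 0 < q -> q < 1 ->
  elephant_random_walk p q X U coin ->
  y != 0 ->
  (0 < P [set t | erw_position X m t = y%:~R])%E ->
  (fun N : nat =>
     Num.sqrt (erw_A p (m + N)%N - erw_A p m) *
     cond_prob P
       [set t | (N%:R%:E < first_zero_after (fun n => erw_position X n t) m)%E]
       [set t | erw_position X m t = y%:~R])
    @ \oo --> Num.sqrt (2 / pi) * `|y%:~R| * erw_a p m.
Proof.
move=> p0 p34 q0 q1 hw y0 Pm.
have start : alive_event X m y 0 = [set t | erw_position X m t = y%:~R].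
  by apply/seteqP; split=> t /= => [[]//|Xm]; split=> // k; lia.
rewrite -start in Pm.
have kw := walk_weight_killed hw y0 Pm.
have nrm := erw_a_normalizing p0 p34.
have lim := survival_cvg kw nrm.
have condE N : cond_prob P
    [set t | (N%:R%:E < first_zero_after (fun n => erw_position X n t) m)%E]
    [set t | erw_position X m t = y%:~R] = survival (walk_weight X m y) (m + N).
  rewrite (survival_walk_weight hw) ?addn_gt0 ?(killed_m_gt0 kw) // /cond_prob -start.
  congr (fine (P _) / _); apply/seteqP; split=> t /=.
    by case=> /lt_first_zero_after nz [Xm _]; split.
  by case=> Xm nz; split; [exact/lt_first_zero_after|split=> // k; lia].
under eq_cvg => N do rewrite condE mulrC.
suff -> : Num.sqrt (2 / pi) * `|y%:~R| * erw_a p m =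
    Num.sqrt 2 * (erw_a p m * (`|y|%N)%:R) / Num.sqrt pi by exact: lim.
rewrite natr_absz intr_norm sqrtrM // sqrtrV ?pi_ge0 // -!mulrA; congr (_ * _).
by rewrite mulrC -!mulrA mulrCA.
Qed.
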